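(* Let $R\in\mathcal{R}(d)$ be an R-matrix. (a) $\mathcal{M}^{\lambda_R}\subset\bigcap_{n\ge1}\lambda_R^n(\mathcal{M})\subset\mathcal{L}_R'\cap\mathcal{M}$. (b) $\mathcal{N}^{\lambda_R}=\bigcap_{n\ge1}\lambda_R^n(\mathcal{N})=\mathcal{L}_R'\cap\mathcal{N}$. (c) Let $i,j\in\{1,\dots,d\}$. Then $S_i^*\mathcal{M}^{\lambda_R}S_j\subset\mathcal{M}^{\lambda_R}$ and $S_i^*\mathcal{N}^{\lambda_R}S_j\subset\mathcal{N}^{\lambda_R}$.
   Context: Let $d\ge 2$. $\mathcal{O}_d$ is the Cuntz algebra generated by isometries $S_1,\dots,S_d$ with $S_i^*S_j=\delta_{ij}1$, $\sum_iS_iS_i^*=1$. $\mathcal{F}_d^n=\mathrm{span}\{S_\mu S_\nu^*:|\mu|=|\nu|=n\}\cong M_d^{\otimes n}$, and $\mathcal{F}_d$ is the norm closure of $\bigcup_n\mathcal{F}_d^n$. A unitary $u\in\mathcal{O}_d$ defines the unital endomorphism $\lambda_u$ of $\mathcal{O}_d$ with $\lambda_u(S_i)=uS_i$. The canonical endomorphism is $\varphi(x)=\sum_iS_ixS_i^*$. An R-matrix of dimension $d$ is a unitary $R$ on $\mathbb{C}^d\otimes\mathbb{C}^d$ with $(R\otimes1)(1\otimes R)(R\otimes1)=(1\otimes R)(R\otimes1)(1\otimes R)$; via $M_d\otimes M_d\cong\mathcal{F}_d^2$ it is a unitary in $\mathcal{F}_d^2$ with $R\varphi(R)R=\varphi(R)R\varphi(R)$.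 $\mathcal{R}(d)$ is the set of all these. $\tau$ is the normalized trace on $\mathcal{F}_d$, $E^0(x)=\frac1{2\pi}\int_0^{2\pi}\lambda_{e^{it}1}(x)\,dt$, $\omega=\tau\circ E^0$, $\mathcal{M}=\pi_\omega(\mathcal{O}_d)''$, $\mathcal{N}=\pi_\omega(\mathcal{F}_d)''$ ($\pi_\omega$ the faithful GNS representation, suppressed in notation). For unitary $u\in\mathcal{F}_d$, $\lambda_u$ extends to a normal $\omega$-preserving endomorphism of $\mathcal{M}$ leaving $\mathcal{N}$ invariant. $\mathcal{M}^{\lambda_R}=\{x\in\mathcal{M}:\lambda_R(x)=x\}$, $\mathcal{N}^{\lambda_R}=\mathcal{M}^{\lambda_R}\cap\mathcal{N}$. $\mathcal{L}_R\subset\mathcal{N}$ is the von Neumann algebra generated by $\{\varphi^k(R):k\ge0\}$. *)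

(* Defs.v *)
From mathcomp Require Import all_boot all_order all_algebra.
From mathcomp Require Import sesquilinear spectral.
From mathcomp Require Import all_classical all_reals all_analysis.
From mathcomp Require Import complex mxtens.

Set Implicit Arguments.
Unset Strict Implicit.
Unset Printing Implicit Defensive.

Import Order.TTheory GRing.Theory Num.Theory.
Import numFieldNormedType.Exports.

Local Open Scope classical_set_scope.
Local Open Scope ring_scope.

(* A unital C*-algebra; the norm is real-valued. *)
Record cstarAlgType (R : realType) : Type := CStarAlg {
  cstar_alg :> algType R[i];
  star : cstar_alg -> cstar_alg;
  cnorm : cstar_alg -> R;
  starK : involutive star;
  starD : {morph star : x y / x + y};
  starZ : forall (a : R[i]) x, star (a *: x) = a^*%C *: star x;
  starM : forall x y, star (x * y) = star y * star x;
  cnorm_eq0 : forall x, cnorm x = 0 -> x = 0;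
  cnormD : forall x y, cnorm (x + y) <= cnorm x + cnorm y;
  cnormZ : forall (a : R[i]) x, (cnorm (a *: x))%:C%C = `|a| * (cnorm x)%:C%C;
  cnormM : forall x y, cnorm (x * y) <= cnorm x * cnorm y;
  cnorm_star : forall x, cnorm (star x * x) = cnorm x ^+ 2;
  cnorm_complete : forall u : nat -> cstar_alg,
    (forall e : R, 0 < e -> exists n0 : nat, forall m n : nat,
       (n0 <= m)%N -> (n0 <= n)%N -> cnorm (u m - u n) < e) ->
    exists l, (fun n => cnorm (u n - l)) @ \oo --> (0 : R)
}.

Section CStar.
Variables (R : realType) (A : cstarAlgType R).

Definition unitary (u : A) : Prop := star u * u = 1 /\ u * star u = 1.

Definition cclosure (B : set A) : set A :=
  [set x | forall e : R, 0 < e -> exists2 y, B y & cnorm (x - y) < e].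

Definition closed_star_subalgebra (B : set A) : Prop :=
  [/\ B 1,
      forall (a : R[i]) x y, B x -> B y -> B (a *: x + y),
      forall x y, B x -> B y -> B (x * y),
      forall x, B x -> B (star x) &
      cclosure B `<=` B].

Definition unital_star_endomorphism (f : A -> A) : Prop :=
  [/\ linear f, {morph f : x y / x * y}, f 1 = 1 & {morph f : x / star x}].

(* Norm-convergent Riemann integral over [a, b]: p 0 <= .. <= p n is the
   partition and s 0, .., s (n-1) are the tags; other values are irrelevant. *)
Definition is_riemann_integral (f : R -> A) (a b : R) (I : A) : Prop :=
  forall e : R, 0 < e -> exists2 delta : R, 0 < delta &
    forall (n : nat) (p s : nat -> R),
      p 0%N = a -> p n = b ->
      (forall k, (k < n)%N ->
         [/\ p k <= s k, s k <= p k.+1 & p k.+1 - p k < delta]) ->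
      cnorm (\sum_(k < n) (p k.+1 - p k)%:C%C *: f (s k) - I) < e.

End CStar.

Section Cuntz.
Variables (R : realType) (d : nat) (A : cstarAlgType R) (S : 'I_d -> A).

Record is_cuntz_algebra : Prop := {
  cuntz_orth : forall i j, star (S i) * S j = (i == j)%:R;
  cuntz_sum : \sum_i S i * star (S i) = 1;
  cuntz_gen : forall B : set A, closed_star_subalgebra B ->
    (forall i, B (S i)) -> B = setT
}.

Definition Sword (n : nat) (mu : n.-tuple 'I_d) : A := \prod_(i <- mu) S i.

Definition Fn (n : nat) : set A :=
  [set x | exists c : n.-tuple 'I_d -> n.-tuple 'I_d -> R[i],
     x = \sum_mu \sum_nu c mu nu *: (Sword mu * star (Sword nu))].

Definition Fd : set A := cclosure (\bigcup_n Fn n).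

Definition canonical_endo (x : A) : A := \sum_i S i * x * star (S i).

Definition is_lambda (lambda : A -> A -> A) : Prop :=
  forall u, unitary u ->
    unital_star_endomorphism (lambda u) /\
    forall i, lambda u (S i) = u * S i.

Definition is_normalized_trace (tau : A -> R[i]) : Prop :=
  [/\ forall (a : R[i]) x y, Fd x -> Fd y ->
        tau (a *: x + y) = a * tau x + tau y,
      forall x, Fd x -> 0 <= tau (star x * x),
      tau 1 = 1 &
      forall x y, Fd x -> Fd y -> tau (x * y) = tau (y * x)].

Definition is_gauge_expectation (lambda : A -> A -> A) (E0 : A -> A) : Prop :=
  forall x, exists2 I : A,
    is_riemann_integral
      (fun t : R => lambda ((cos t +i* sin t)%C *: 1) x) 0 (2 * pi) I &
    E0 x = ((2 * pi)^-1)%:C%C *: I.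

(* M_d (x) M_d -> F_d^2, E_ik (x) E_jl |-> S_i S_j S_l^* S_k^* *)
Definition mx2_embed (r : 'M[R[i]]_(d * d)) : A :=
  \sum_i \sum_j \sum_k \sum_l
    r (mxtens_index (i, j)) (mxtens_index (k, l)) *:
      (S i * S j * star (S k * S l)).

End Cuntz.

Definition is_rmatrix (C : numClosedFieldType) (d : nat)
    (r : 'M[C]_(d * d)) : Prop :=
  let r12 : 'M[C]_(d * d * d) := r *t (1%:M : 'M[C]_d) in
  let r23 : 'M[C]_(d * d * d) :=
    castmx (mulnA d d d, mulnA d d d) ((1%:M : 'M[C]_d) *t r) in
  r \is unitarymx /\ r12 *m r23 *m r12 = r23 *m r12 *m r23.

Section Operators.
Variables (R : realType) (H : completeNormedModType R[i]).
Variable dot : {dot H for Num.conj}.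

(* [dot] is linear in its first argument. Together with completeness of [H]
   this makes H a Hilbert space. *)
Definition is_hilbert_dot : Prop := forall v : H, `|v| ^+ 2 = dot v v.

Definition bounded_ops : set (H -> H) :=
  [set T | linear T /\ continuous T].

Definition adjoint_ops (T T' : H -> H) : Prop :=
  forall v w, dot (T v) w = dot v (T' w).

Definition commutant (X : set (H -> H)) : set (H -> H) :=
  [set T | bounded_ops T /\ forall x, X x -> T \o x = x \o T].

Definition bicommutant (X : set (H -> H)) : set (H -> H) :=
  commutant (commutant X).

Definition is_von_neumann_algebra (N : set (H -> H)) : Prop :=
  [/\ N `<=` bounded_ops,
      forall T T', N T -> bounded_ops T' -> adjoint_ops T T' -> N T' &
      bicommutant N = N].

Definition vn_generated (X : set (H -> H)) : set (H -> H) :=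
  [set T | forall N, is_von_neumann_algebra N -> X `<=` N -> N T].

Definition positive_part (M : set (H -> H)) : set (H -> H) :=
  [set T | M T /\ forall v, 0 <= dot (T v) v].

Definition op_le (T T' : H -> H) : Prop :=
  forall v, dot (T v) v <= dot (T' v) v.

(* Supremum within the positive part of M of a set D of positive elements;
   in [is_normal_map], normality is preservation of suprema of increasing nets. *)
Definition op_lub (M D : set (H -> H)) (x : H -> H) : Prop :=
  [/\ positive_part M x,
      forall T, D T -> op_le T x &
      forall y, positive_part M y -> (forall T, D T -> op_le T y) -> op_le x y].

Definition op_directed (D : set (H -> H)) : Prop :=
  D !=set0 /\ forall T T', D T -> D T' ->
    exists U, [/\ D U, op_le T U & op_le T' U].

Definition is_normal_map (M : set (H -> H)) (f : (H -> H) -> (H -> H)) : Prop :=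
  forall D x, D `<=` positive_part M -> op_directed D -> op_lub M D x ->
    op_lub M (f @` D) (f x).

(* Operators on [H] are bare functions, so a map of M is encoded by a map [f] on
   all functions H -> H whose values outside M are irrelevant. *)
Record is_normal_endomorphism (M : set (H -> H))
    (f : (H -> H) -> (H -> H)) : Prop := {
  nendo_stable : forall x, M x -> M (f x);
  nendo_linear : forall (a : R[i]) x y, M x -> M y ->
    f (fun v => a *: x v + y v) = (fun v => a *: f x v + f y v);
  nendo_mul : forall x y, M x -> M y -> f (x \o y) = f x \o f y;
  nendo_unit : f idfun = idfun;
  nendo_star : forall x y, M x -> M y -> adjoint_ops x y ->
    adjoint_ops (f x) (f y);
  nendo_normal : is_normal_map M f
}.

Variable A : cstarAlgType R.

Record is_representation (rho : A -> H -> H) : Prop := {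
  rep_bounded : forall x, bounded_ops (rho x);
  rep_linear : forall (a : R[i]) x y,
    rho (a *: x + y) = (fun v => a *: rho x v + rho y v);
  rep_mul : forall x y, rho (x * y) = rho x \o rho y;
  rep_unit : rho 1 = idfun;
  rep_star : forall x, adjoint_ops (rho x) (rho (star x))
}.

(* The GNS triple of [omega], which is determined up to unitary equivalence. *)
Definition is_gns (omega : A -> R[i]) (rho : A -> H -> H) (Omega : H) : Prop :=
  [/\ is_representation rho,
      closure (range (fun x => rho x Omega)) = setT &
      forall x, dot (rho x Omega) Omega = omega x].

(* For g = lambda_u with u a unitary of F_d, omega-invariance and stability of N
   are consequences of normality; they are recorded as part of the known
   properties of the extension. *)
Record is_extension (rho : A -> H -> H) (Omega : H) (M N : set (H -> H))
    (g : A -> A) (f : (H -> H) -> (H -> H)) : Prop := {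
  ext_endo : is_normal_endomorphism M f;
  ext_extends : forall x, f (rho x) = rho (g x);
  ext_state : forall x, M x -> dot (f x Omega) Omega = dot (x Omega) Omega;
  ext_stable : f @` N `<=` N
}.

Definition fixed_points (M : set (H -> H)) (f : (H -> H) -> (H -> H)) :
  set (H -> H) := [set x | M x /\ f x = x].

Definition iterated_ranges (M : set (H -> H)) (f : (H -> H) -> (H -> H)) :
  set (H -> H) := \bigcap_(n in [set n | (1 <= n)%N]) (iter n f @` M).

End Operators.

(* Main.v *)
Require Import Defs.
From mathcomp Require Import all_boot all_order all_algebra.
From mathcomp Require Import sesquilinear spectral.
From mathcomp Require Import all_classical all_reals all_analysis.
From mathcomp Require Import complex mxtens.
From mathcomp Require Import ring lra.

Set Implicit Arguments.
Unset Strict Implicit.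
Unset Printing Implicit Defensive.

Import Order.TTheory GRing.Theory Num.Theory.
Import numFieldNormedType.Exports.

Local Open Scope classical_set_scope.
Local Open Scope ring_scope.

(** Write [phi] for the canonical endomorphism, [g] for the endomorphism of the
    Cuntz algebra given by [R], and [f] for its extension to [M].

    The algebra behind the statement is short. The braid relation says that [R]
    commutes with the range of [g^2] ([endo2_comm]) and that [g] maps [phi^k R] to
    [phi^(k+1) R] ([endo_phi_iter]). Hence [phi^k R] commutes with the range of
    [g^(k+2)], and an element in the range of all iterates commutes with all
    generators of [L]; a fixed point is such an element. In the opposite
    direction, on the span of the [S_mu S_nu^*] with [mu] and [nu] of length [n],
    [g] is conjugation by the unitary [R phi(R) ... phi^(n-1)(R)] of [L]
    ([endo_core]), so that an element of [N] commuting with [L] should be fixed.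
    Finally [f] maps [S_i^* x S_j] to [S_i^* R^* x R S_j], which is [S_i^* x S_j]
    when [x] is a fixed point, as [x] then commutes with [R].

    The analytical part is the passage from words to [M] and [N]. It rests on two
    properties of the vector [Omega], and uses no weak topology. First, [Omega]
    is separating for [M] ([separating]): the expectation and the trace determine
    the state on words ([omega_monomial]), the values give the KMS property
    [omega_gen], and this makes right multiplication by a word a bounded operator in
    the commutant of the representation, so that [Omega] is cyclic for the
    commutant. For a unitary of the core this right multiplication is isometric.
    Secondly, [f] preserves the state, whence [|f(m) Omega| = |m Omega|]
    ([f_isometric]). An identity between operators of [M] may therefore be tested
    on [Omega], where both sides are limits of their values on words. This gives
    commutation of [R] with the range of [f^2] ([f2_comm]), and invariance of the
    elements of [N] commuting with [L] ([core_fixed]). For the latter, [m Omega]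
    with [m] in [N] has to be approximated by core vectors ([N_approx]), which is
    done by the projection onto their closure.

    Adjoints and projections come from a variational form of the Riesz theorem
    ([riesz]), and continuity of the representation in the C*-norm from an
    invertibility argument ([rep_contractive]). *)

(** * Bounded operators on a normed space *)

Section LinearMaps.
Variables (K : nzRingType) (U V : lmodType K) (f : U -> V).
Hypothesis f_lin : linear f.

Lemma lin_add u v : f (u + v) = f u + f v.
Proof. by have := f_lin 1 u v; rewrite !scale1r. Qed.

Lemma lin_0 : f 0 = 0.
Proof. by apply: (addrI (f 0)); rewrite -lin_add !addr0. Qed.

Lemma lin_scale a u : f (a *: u) = a *: f u.
Proof. by have := f_lin a u 0; rewrite lin_0 !addr0. Qed.

Lemma lin_opp u : f (- u) = - f u.
Proof. by rewrite -scaleN1r lin_scale scaleN1r. Qed.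

Lemma lin_sub u v : f (u - v) = f u - f v.
Proof. by rewrite lin_add lin_opp. Qed.

Lemma lin_sum (I : Type) (r : seq I) (F : I -> U) :
  f (\sum_(i <- r) F i) = \sum_(i <- r) f (F i).
Proof. by apply: big_morph; [exact: lin_add|exact: lin_0]. Qed.

End LinearMaps.

Section Norm.
Variables (R : realType) (H : completeNormedModType R[i]).
Implicit Types (u v w : H) (a : R[i]) (T U : H -> H) (e c : R).

(** The norm of [H] takes values in [R[i]], whose order is partial; estimates
    are done with its real value. *)
Definition hn v : R := complex.Re `|v|.

Lemma hnE v : `|v| = (hn v)%:C%C.
Proof. by rewrite /hn RRe_real // normr_real. Qed.

Lemma hn_ge0 v : 0 <= hn v.
Proof. by rewrite -ler0c -hnE normr_ge0. Qed.

Lemma hn0_eq0 v : hn v = 0 -> v = 0.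
Proof. by move=> h; apply/eqP; rewrite -normr_eq0 hnE h. Qed.

Lemma hn0 : hn 0 = 0.
Proof. by rewrite /hn normr0. Qed.

Lemma hnN v : hn (- v) = hn v.
Proof. by rewrite /hn normrN. Qed.

Lemma hn_distC u v : hn (u - v) = hn (v - u).
Proof. by rewrite -hnN opprB. Qed.

Lemma hnD u v : hn (u + v) <= hn u + hn v.
Proof. by rewrite -lecR -hnE rmorphD /= -!hnE ler_normD. Qed.

Lemma hnB u v : hn (u - v) <= hn u + hn v.
Proof. by rewrite -[hn v]hnN hnD. Qed.

Lemma hn_triangle w u v : hn (u - v) <= hn (u - w) + hn (w - v).
Proof. by rewrite -[u - v](subrKA w) hnD. Qed.

Lemma hnZ a v : hn (a *: v) = complex.Re `|a| * hn v.
Proof.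
by apply: complexI; rewrite -hnE normrZ hnE rmorphM; congr (_ * _).
Qed.

Lemma hnZr c v : hn (c%:C%C *: v) = `|c| * hn v.
Proof.
by rewrite hnZ normc_def /= expr0n /= addr0 sqrtr_sqr.
Qed.

Lemma hn_small_eq0 v : (forall e, 0 < e -> hn v <= e) -> v = 0.
Proof.
move=> h; apply: hn0_eq0; apply/eqP; rewrite eq_le hn_ge0 andbT.
by apply/ler_addgt0Pr => e e0; rewrite add0r; apply: h.
Qed.

Definition hcl (D : set H) : set H :=
  [set v | forall e, 0 < e -> exists2 w, D w & hn (v - w) < e].

Lemma complex_gt0 (e : R[i]) : 0 < e -> exists2 e', 0 < e' & e = e'%:C%C.
Proof.
move=> e0; exists (complex.Re e); last by rewrite RRe_real // gtr0_real.
by move: e0; rewrite ltcE /= => /andP[].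
Qed.

Lemma hball v e w : ball v e%:C%C w = (hn (v - w) < e).
Proof. by rewrite -ball_normE /= hnE ltcR. Qed.

Lemma closure_hcl (D : set H) v : closure D v <-> hcl D v.
Proof.
split=> [cl e e0|cl B /nbhs_ballP[e /= /complex_gt0[e' e0 ->]] sB].
  have /cl[w [Dw]] : nbhs v (ball v e%:C%C) by apply: nbhsx_ballx; rewrite ltcR.
  by rewrite hball => bw; exists w.
have [w Dw vw] := cl _ e0.
by exists w; split => //; apply: sB; rewrite hball.
Qed.

Lemma hn_complete (u : nat -> H) :
  (forall e, 0 < e -> exists n0 : nat, forall m n,
     (n0 <= m)%N -> (n0 <= n)%N -> hn (u m - u n) < e) ->
  exists l, forall e, 0 < e -> exists n0 : nat, forall n, (n0 <= n)%N ->
     hn (u n - l) < e.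
Proof.
move=> cu.
have /cvg_ex[l ul] : cvgn u.
  apply: cauchy_cvg; apply: cauchy_exP => e /complex_gt0[e' e0 ->].
  have [n0 h] := cu _ e0; exists (u n0).
  by exists n0 => // n /= n0n; rewrite hball; apply: h.
exists l => e e0.
have : nbhs l (ball l e%:C%C) by apply: nbhsx_ballx; rewrite ltcR.
by move=> /ul[n0 _ h]; exists n0 => n /h; rewrite /= hball hn_distC.
Qed.

Lemma bounded_opsP T : bounded_ops T <->
  linear T /\ exists2 c, 0 <= c & forall v, hn (T v) <= c * hn v.
Proof.
split=> -[linT].
  move=> contT; split=> //.
  have T0 := lin_0 linT; have Tz := lin_scale linT.
  have := contT 0 (ball (T 0) (1%:C%C)).
  case/(_ _)/nbhs_ballP; first by apply: nbhsx_ballx; rewrite ltcR.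
  move=> e /= /complex_gt0[e' e0 ->] h.
  exists (2 / e'); first by rewrite divr_ge0 // ltW.
  move=> v; have [->|v0] := eqVneq v 0; first by rewrite T0 hn0 mulr0.
  have nv : 0 < hn v.
    by rewrite lt_def hn_ge0 andbT; apply: contra v0 => /eqP/hn0_eq0 ->.
  pose k := e' / 2 / hn v.
  have k0 : 0 < k by rewrite !divr_gt0.
  have := h (k%:C%C *: v).
  rewrite /= !hball T0 !sub0r !hnN Tz !hnZr gtr0_norm //.
  have -> : k * hn v = e' / 2 by rewrite /k divfK // gt_eqF.
  rewrite -subr_gt0 [e' in e' - _](splitr e') addrK divr_gt0 // => /(_ isT).
  rewrite mulrC -ltr_pdivlMr // => /ltW /le_trans; apply.
  rewrite (_ : 1 / k = 2 / e' * hn v) //; rewrite /k; field.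
  by rewrite !gt_eqF.
move=> [c c0 bT]; split=> // v B /nbhs_ballP[e /= /complex_gt0[e' e0 ->]] sB.
apply/nbhs_ballP; exists (e' / (c + 1))%:C%C.
  by rewrite /= ltcR divr_gt0 // ltr_wpDl.
move=> w; rewrite hball => vw; apply: sB; rewrite hball.
rewrite -(lin_sub linT).
apply: le_lt_trans (bT _) _.
have [z|] := eqVneq c 0; first by rewrite z mul0r.
move=> cn0; apply: (@lt_trans _ _ (c * (e' / (c + 1)))).
  by rewrite ltr_pM2l // lt_def cn0.
rewrite mulrCA gtr_pMr // ltr_pdivrMr ?mul1r; last by rewrite ltr_wpDl.
by rewrite ltrDl.
Qed.

End Norm.

(** * The Riesz representation theorem *)

Section Hilbert.
Variables (R : realType) (H : completeNormedModType R[i]).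
Variable dot : {dot H for Num.conj}.
Hypothesis dotP : is_hilbert_dot dot.
Implicit Types (u v w : H) (a : R[i]) (T U : H -> H) (e c : R).

Lemma dotDl u v w : dot (u + v) w = dot u w + dot v w.
Proof. exact: linearDl. Qed.
Lemma dotBl u v w : dot (u - v) w = dot u w - dot v w.
Proof. exact: linearBl. Qed.
Lemma dotZl a u w : dot (a *: u) w = a * dot u w.
Proof. by rewrite linearZl_LR. Qed.
Lemma dotDr u v w : dot w (u + v) = dot w u + dot w v.
Proof. exact: linearDr. Qed.
Lemma dotBr u v w : dot w (u - v) = dot w u - dot w v.
Proof. exact: linearBr. Qed.
Lemma dotC u v : dot u v = (dot v u)^*%C.
Proof. by rewrite hermC expr0 mul1r. Qed.
Lemma dotZr a u w : dot w (a *: u) = a^*%C * dot w u.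
Proof. by rewrite dotC dotZl rmorphM /= -dotC. Qed.
Lemma dot_hn v : dot v v = (hn v ^+ 2)%:C%C.
Proof. by rewrite -dotP hnE rmorphXn. Qed.

Lemma dot_inj u v : (forall w, dot w u = dot w v) -> u = v.
Proof.
move=> h; apply/eqP; rewrite -subr_eq0 -(dnorm_eq0 dot).
by rewrite dotBr h subrr.
Qed.

Definition rdot u v : R := complex.Re (dot u v).

Lemma rdotC u v : rdot u v = rdot v u.
Proof. by rewrite /rdot dotC; case: (dot v u). Qed.
Lemma rdotDl u v w : rdot (u + v) w = rdot u w + rdot v w.
Proof. by rewrite /rdot dotDl raddfD. Qed.
Lemma rdotBl u v w : rdot (u - v) w = rdot u w - rdot v w.
Proof. by rewrite /rdot dotBl raddfB. Qed.
Lemma rdotNl u w : rdot (- u) w = - rdot u w.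
Proof. by rewrite /rdot linearNl raddfN. Qed.
Lemma rdotDr u v w : rdot w (u + v) = rdot w u + rdot w v.
Proof. by rewrite /rdot dotDr raddfD. Qed.
Lemma rdotBr u v w : rdot w (u - v) = rdot w u - rdot w v.
Proof. by rewrite /rdot dotBr raddfB. Qed.
Lemma rdotZl c u w : rdot (c%:C%C *: u) w = c * rdot u w.
Proof. by rewrite /rdot dotZl; case: (dot u w) => x y /=; rewrite mul0r subr0. Qed.
Lemma rdotZr c u w : rdot w (c%:C%C *: u) = c * rdot w u.
Proof. by rewrite rdotC rdotZl rdotC. Qed.
Lemma rdot_hn v : rdot v v = hn v ^+ 2.
Proof. by rewrite /rdot dot_hn. Qed.

Lemma hn_sqrD u v : hn (u + v) ^+ 2 = hn u ^+ 2 + 2 * rdot u v + hn v ^+ 2.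
Proof.
by rewrite -!rdot_hn rdotDl !rdotDr (rdotC v u); ring.
Qed.

Lemma hn_sqrB u v : hn (u - v) ^+ 2 = hn u ^+ 2 - 2 * rdot u v + hn v ^+ 2.
Proof.
by rewrite -!rdot_hn rdotBl !rdotBr (rdotC v u); ring.
Qed.

Lemma rdot_le u v : rdot u v <= hn u * hn v.
Proof.
have := hnD u v; rewrite -(@ler_pXn2r _ 2) ?nnegrE ?addr_ge0 ?hn_ge0 //.
by rewrite hn_sqrD; nra.
Qed.

Lemma normr_rdot_le u v : `|rdot u v| <= hn u * hn v.
Proof.
rewrite ler_norml rdot_le andbT lerNl.
have := rdot_le (- u) v; rewrite hnN; apply: le_trans.
by rewrite rdotNl.
Qed.

Lemma normr_dot_le u v : `|dot u v| <= (hn u * hn v)%:C%C.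
Proof.
set z := dot u v; have [z0|z0] := eqVneq z 0.
  by rewrite z0 normr0 ler0c mulr_ge0 ?hn_ge0.
have := rdot_le (z^*%C *: u) v.
rewrite /rdot dotZl -/z mulrC hnZ -lecR.
rewrite -sqr_normc normcJ.
have zR : `|z| = (complex.Re `|z|)%:C%C by rewrite RRe_real ?normr_real.
have z1 : 0 < complex.Re `|z| by rewrite -ltcR -zR normr_gt0.
rewrite {1 3}zR; move: (complex.Re `|z|) z1 => t t0.
rewrite -rmorphXn /= !lecR expr2 -mulrA; by rewrite ler_pM2l.
Qed.

Definition closed_subspace (K : set H) : Prop :=
  [/\ K 0, forall a u v, K u -> K v -> K (a *: u + v) & hcl K `<=` K].

(** The vector sought minimises [|u|^2 - 2 Re <T u, w>] over [K]: the
    parallelogram law makes minimising sequences Cauchy, and the first variation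
    at the minimum is the required identity. Taking [K = H] gives adjoints,
    taking [T = id] gives orthogonal projections. *)
Lemma riesz (K : set H) T w : closed_subspace K -> bounded_ops T ->
  exists2 u, K u & forall k, K k -> dot k u = dot (T k) w.
Proof.
move=> [K0 Klin Kcl] /bounded_opsP[linT [c c0 bT]].
have KD u v : K u -> K v -> K (u + v).
  by move=> Ku Kv; rewrite -[u]scale1r; apply: Klin.
have KZ a u : K u -> K (a *: u) by move=> Ku; rewrite -[_ *: _]addr0; apply: Klin.
pose J u := hn u ^+ 2 - 2 * rdot (T u) w.
pose E := [set J u | u in K].
have lbE : lbound E (- (c * hn w) ^+ 2).
  move=> _ [u Ku <-]; rewrite /J.
  have := rdot_le (T u) w; have := bT u.
  have := hn_ge0 w; have := hn_ge0 u.
  move: (rdot _ _) (hn (T u)) (hn u) (hn w) => g b p q p0 q0 h1 h2.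
  have h3 : g <= c * p * q by apply: le_trans h2 _; rewrite ler_wpM2r.
  have := sqr_ge0 (p - c * q); nra.
have hasE : has_inf E by split; [exists (J 0), 0|exists (- (c * hn w) ^+ 2)].
pose m := inf E.
have mle u : K u -> m <= J u by move=> Ku; apply: ge_inf; [case: hasE|exists u].
have /choice[s sP] (n : nat) : exists u, K u /\ J u < m + n.+1%:R^-1.
  have [|_ [u Ku <-] Jm] := @inf_adherent _ E n.+1%:R^-1 _ hasE.
    by rewrite invr_gt0.
  by exists u.
have small e : 0 < e -> exists n0, forall n, (n0 <= n)%N -> J (s n) < m + e.
  move=> e0; have [n _ ne] := near_infty_natSinv_lt (PosNum e0).
  exists n => p /ne /= h; have [_ h2] := sP p.
  by apply: lt_trans h2 _; rewrite ltrD2l.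
(* The parallelogram law, with the midpoint of [u] and [v] as competitor. *)
have cauchy_est u v : K u -> K v -> hn (u - v) ^+ 2 <= 2 * (J u - m) + 2 * (J v - m).
  move=> Ku Kv; have := mle ((2^-1 : R)%:C%C *: (u + v)) (KZ _ _ (KD _ _ Ku Kv)).
  rewrite /J (lin_scale linT) (lin_add linT) rdotZl hnZr rdotDl.
  rewrite gtr0_norm ?invr_gt0 // exprMn (hn_sqrD u v) (hn_sqrB u v).
  by lra.
have [l lP] : exists l, forall e, 0 < e -> exists n0 : nat, forall n,
    (n0 <= n)%N -> hn (s n - l) < e.
  apply: hn_complete => e e0.
  have e1 : 0 < e ^+ 2 / 4 by rewrite divr_gt0 // exprn_gt0.
  have [n0 h] := small _ e1; exists n0 => p q /h hp /h hq.
  rewrite -(@ltr_pXn2r _ 2) ?nnegrE ?hn_ge0 ?ltW //.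
  have [Kp _] := sP p; have [Kq _] := sP q.
  apply: le_lt_trans (cauchy_est _ _ Kp Kq) _; lra.
have Kl : K l.
  apply: Kcl => e /lP[n h]; exists (s n); first by have [] := sP n.
  by rewrite hn_distC h.
have var k : K k -> rdot l k = rdot (T k) w.
  move=> Kk; apply/eqP; rewrite -subr_eq0 -normr_eq0 eq_le normr_ge0 andbT.
  have [->|k0] := eqVneq k 0.
    by rewrite (lin_0 linT) rdotC -(subrr k) !rdotBl !subrr normr0.
  have nk : 0 < hn k.
    by rewrite lt_def hn_ge0 andbT; apply: contra k0 => /eqP/hn0_eq0 ->.
  apply/ler_addgt0Pr => e' e'0; rewrite add0r.
  have [e e0 ->] : exists2 e, 0 < e & e' = 2 * e * hn k.
    exists (e' / (2 * hn k)); first by rewrite divr_gt0 // mulr_gt0.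
    by field; rewrite gt_eqF.
  have [n1 h1] := lP _ e0.
  have [n2 h2] := small _ (exprn_gt0 2 e0).
  pose n := maxn n1 n2.
  have {}h1 := h1 n (leq_maxl _ _).
  have {}h2 := h2 n (leq_maxr _ _).
  have [Kn _] := sP n; move: (s n) Kn h1 h2 => u Ku h1 h2.
  pose al := rdot u k - rdot (T k) w.
  have hal : al ^+ 2 <= e ^+ 2 * hn k ^+ 2.
    (* The multiple of [k] that decreases [J] the most. *)
    pose t := - al / hn k ^+ 2.
    have := mle (u + t%:C%C *: k) (KD _ _ Ku (KZ _ _ Kk)).
    move: h2; rewrite /J (lin_add linT) (lin_scale linT) rdotDl rdotZl hn_sqrD.
    rewrite rdotZr hnZr exprMn real_normK ?num_real // => h2 h3.
    have h4 : 0 <= e ^+ 2 + (2 * t * al + t ^+ 2 * hn k ^+ 2).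
      by rewrite /al; lra.
    have h5 : 2 * t * al + t ^+ 2 * hn k ^+ 2 = - (al ^+ 2 / hn k ^+ 2).
      by rewrite /t; field; rewrite gt_eqF.
    by move: h4; rewrite h5 subr_ge0 ler_pdivrMr ?exprn_gt0.
  have hal' : `|al| <= e * hn k.
    rewrite -(@ler_pXn2r _ 2) ?nnegrE ?mulr_ge0 ?hn_ge0 ?(ltW e0) //.
    by rewrite real_normK ?num_real // exprMn.
  have -> : rdot l k - rdot (T k) w = al - rdot (u - l) k.
    by rewrite /al rdotBl; ring.
  apply: le_trans (ler_normB _ _) _; have := normr_rdot_le (u - l) k.
  nra.
exists l => // k Kk; apply/eqP; rewrite eq_complex; apply/andP; split.
  by have := var k Kk; rewrite rdotC => /eqP.
(* The imaginary part is the real part for ['i *: k]. *)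
have := var ('i%C *: k) (KZ _ _ Kk); rewrite rdotC (lin_scale linT) /rdot !dotZl.
by rewrite mulrC ReiNIm mulrC ReiNIm => /oppr_inj/eqP.
Qed.

End Hilbert.

(** * Adjoints, projections and commutants *)

Section BoundedOps.
Variables (R : realType) (H : completeNormedModType R[i]).
Variable dot : {dot H for Num.conj}.
Hypothesis dotP : is_hilbert_dot dot.
Implicit Types (u v w : H) (a : R[i]) (T U : H -> H) (e c : R).

Lemma bounded_lin T : bounded_ops T -> linear T.
Proof. by case. Qed.

Lemma bounded_id : @bounded_ops R H idfun.
Proof. by apply/bounded_opsP; split=> //; exists 1 => // v; rewrite mul1r. Qed.

Lemma bounded_comp T U : bounded_ops T -> bounded_ops U -> bounded_ops (T \o U).
Proof.
move=> /bounded_opsP[lT [c c0 bT]] /bounded_opsP[lU [c' c'0 bU]].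
apply/bounded_opsP; split=> [a u v|]; first by rewrite /= lU lT.
exists (c * c') => [|v /=]; first exact: mulr_ge0.
by apply: le_trans (bT _) _; rewrite -mulrA ler_wpM2l.
Qed.

Lemma bounded_linearcomb a T U : bounded_ops T -> bounded_ops U ->
  bounded_ops (fun v => a *: T v + U v).
Proof.
move=> /bounded_opsP[lT [c c0 bT]] /bounded_opsP[lU [c' c'0 bU]].
have a0 : 0 <= complex.Re `|a| by rewrite -ler0c RRe_real ?normr_real.
apply/bounded_opsP; split=> [b u v|].
  rewrite lU lT !scalerDr !scalerA (mulrC b a) -!addrA; congr (_ + _).
  by rewrite addrCA.
exists (complex.Re `|a| * c + c') => [|v /=]; first by rewrite addr_ge0 ?mulr_ge0.
apply: le_trans (hnD _ _) _; rewrite hnZ mulrDl lerD // -mulrA.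
by rewrite ler_wpM2l.
Qed.

Lemma bounded_sub T U : bounded_ops T -> bounded_ops U ->
  bounded_ops (fun v => T v - U v).
Proof.
move=> bT bU; have := bounded_linearcomb (-1) bU bT.
by congr (bounded_ops _); apply/funext => v; rewrite scaleN1r addrC.
Qed.

Lemma bounded_0 : @bounded_ops R H (fun=> 0).
Proof.
have := bounded_sub bounded_id bounded_id.
by congr (bounded_ops _); apply/funext => v; rewrite subrr.
Qed.

Lemma bounded_add T U : bounded_ops T -> bounded_ops U ->
  bounded_ops (fun v => T v + U v).
Proof.
move=> bT bU; have := bounded_linearcomb 1 bT bU.
by congr (bounded_ops _); apply/funext => v; rewrite scale1r.
Qed.

Lemma bounded_sum (I : Type) (r : seq I) (F : I -> H -> H) :
  (forall i, bounded_ops (F i)) -> bounded_ops (fun v => \sum_(i <- r) F i v).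
Proof.
move=> bF; elim: r => [|i r IH].
  have := bounded_0; congr (bounded_ops _); apply/funext => v; by rewrite big_nil.
have := bounded_add (bF i) IH; congr (bounded_ops _).
by apply/funext => v; rewrite big_cons.
Qed.

Lemma bounded_eq0_closure U (D : set H) v : bounded_ops U ->
  (forall w, D w -> U w = 0) -> hcl D v -> U v = 0.
Proof.
move=> /bounded_opsP[lU [c c0 bU]] UD cl; apply: hn_small_eq0 => e e0.
have [|w Dw vw] := cl (e / (c + 1)); first by rewrite divr_gt0 // ltr_wpDl.
have -> : U v = U (v - w) by rewrite (lin_sub lU) (UD _ Dw) subr0.
apply: le_trans (bU _) _; have := ltW vw.
rewrite ler_pdivlMr ?ltr_wpDl //; have := hn_ge0 (v - w).
by move: (hn _) => x; nra.
Qed.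

Lemma bounded_eq_dense T U (D : set H) : bounded_ops T -> bounded_ops U ->
  (forall v, hcl D v) -> (forall w, D w -> T w = U w) -> T = U.
Proof.
move=> bT bU dD TU; apply/funext => v; apply/eqP; rewrite -subr_eq0; apply/eqP.
apply: (@bounded_eq0_closure (fun v => T v - U v) D) => //.
  exact: bounded_sub.
by move=> w /TU ->; rewrite subrr.
Qed.

Lemma adjoint_sym T U : adjoint_ops dot T U -> adjoint_ops dot U T.
Proof. by move=> TU v w; rewrite dotC -TU -dotC. Qed.

Lemma adjoint_exists T : bounded_ops T ->
  exists2 U, bounded_ops U & adjoint_ops dot T U.
Proof.
move=> bT; have fullT : closed_subspace (@setT H) by split.
have /choice[U UP] w : exists u, forall k, dot k u = dot (T k) w.
  by have [u _ h] := riesz dotP w fullT bT; exists u => k; apply: h.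
exists U => [|v w]; last by rewrite UP.
have /bounded_opsP[lT [c c0 cT]] := bT.
apply/bounded_opsP; split=> [a u v|].
  by apply: (dot_inj (dot := dot)) => w; rewrite UP !dotDr !dotZr !UP.
exists c => // v; have [->|/eqP U0] := eqVneq (U v) 0.
  by rewrite hn0 mulr_ge0 ?hn_ge0.
have pU : 0 < hn (U v).
  by rewrite lt_def hn_ge0 andbT; apply/eqP => /hn0_eq0.
rewrite -(ler_pM2l pU) -expr2 -(rdot_hn dotP) /rdot UP.
apply: le_trans (rdot_le dotP _ _) _; rewrite mulrCA mulrA ler_wpM2r ?hn_ge0 //.
Qed.

Lemma projection_exists (K : set H) : closed_subspace K ->
  exists P, [/\ bounded_ops P, forall v, K (P v), forall v, K v -> P v = v &
    adjoint_ops dot P P].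
Proof.
move=> Ksub; have [K0 Klin _] := Ksub.
have KB u v : K u -> K v -> K (u - v).
  by move=> Ku Kv; rewrite addrC -scaleN1r; apply: Klin.
have /choice[P PP] w : exists u, K u /\ forall k, K k -> dot k u = dot k w.
  by have [u Ku h] := riesz dotP w Ksub bounded_id; exists u.
have PK v : K (P v) by case: (PP v).
have Pdot k v : K k -> dot k (P v) = dot k v by case: (PP v) => _; apply.
have uniq u v : K u -> K v -> (forall k, K k -> dot k u = dot k v) -> u = v.
  move=> Ku Kv h; apply/eqP; rewrite -subr_eq0 -(dnorm_eq0 dot).
  by rewrite dotBr h ?subrr //; apply: KB.
exists P; split=> //.
- apply/bounded_opsP; split=> [a u v|].
    apply: uniq => // [|k Kk]; first exact: Klin.
    by rewrite Pdot // !dotDr !dotZr !Pdot.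
  exists 1 => // v; rewrite mul1r; have [->|/eqP U0] := eqVneq (P v) 0.
    by rewrite hn0 hn_ge0.
  have pU : 0 < hn (P v).
    by rewrite lt_def hn_ge0 andbT; apply/eqP => /hn0_eq0.
  rewrite -(ler_pM2l pU) -expr2 -(rdot_hn dotP) /rdot Pdot //.
  exact: (rdot_le dotP).
- by move=> v Kv; apply: uniq => // k Kk; rewrite Pdot.
- move=> v w; rewrite -(Pdot (P v) w (PK v)) (dotC dot v).
  by rewrite -(Pdot (P w) v (PK w)) -dotC.
Qed.

(** [T] is the extension by continuity of [p y |-> q y]. The two maps replace a
    densely defined operator, so that well-definedness on the range of [p] is
    part of the estimate. *)
Lemma bounded_extension (V : lmodType R[i]) (p q : V -> H) c :
  linear p -> linear q -> (forall v, hcl (range p) v) ->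
  0 <= c -> (forall y, hn (q y) <= c * hn (p y)) ->
  exists T, [/\ bounded_ops T, forall y, T (p y) = q y &
    forall v, hn (T v) <= c * hn v].
Proof.
move=> lp lq dp c0 qp.
have c1 : 0 < c + 1 by rewrite ltr_wpDl.
pose G v w := forall e, 0 < e -> exists2 y, hn (v - p y) < e & hn (w - q y) < e.
have Gbound v w : G v w -> hn w <= c * hn v.
  move=> Gvw; apply/ler_addgt0Pr => e e0.
  have e1 : 0 < e / (c + 1) by rewrite divr_gt0.
  have [y vy wy] := Gvw _ e1.
  have h1 : hn w <= hn (w - q y) + hn (q y) by rewrite -{1}(subrK (q y) w) hnD.
  have h2 : hn (p y) <= hn v + hn (v - p y).
    by rewrite -{1}[p y](subKr v) hnB.
  have h3 := qp y; move: vy wy; rewrite !ltr_pdivlMr //.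
  have := hn_ge0 (v - p y); have := hn_ge0 (w - q y).
  move: (hn (v - _)) (hn (w - _)) (hn w) (hn (q y)) (hn (p y)) (hn v) h1 h2 h3.
  move=> x1 x2 x3 x4 x5 x6 h1 h2 h3 y1 y2 h4 h5.
  have h6 : c * x5 <= c * x6 + c * x1 by rewrite -mulrDr ler_wpM2l.
  have h7 : (x1 * (c + 1)) * c <= e * c by rewrite ler_wpM2r // ltW.
  have h8 : x2 + c * x1 <= e.
    rewrite -(ler_pM2r c1); lra.
  lra.
have Glin a u v u' v' : G u u' -> G v v' -> G (a *: u + v) (a *: u' + v').
  move=> Gu Gv e e0; set k := complex.Re `|a|.
  have k0 : 0 <= k by rewrite -ler0c RRe_real ?normr_real.
  have e1 : 0 < e / (k + 1) by rewrite divr_gt0 // ltr_wpDl.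
  have [y uy u'y] := Gu _ e1; have [z vz v'z] := Gv _ e1.
  have aux s t s' t' : hn (s - s') < e / (k + 1) -> hn (t - t') < e / (k + 1) ->
      hn (a *: s + t - (a *: s' + t')) < e.
    move=> h1 h2; rewrite opprD addrACA -scalerBr.
    apply: le_lt_trans (hnD _ _) _; rewrite hnZ -/k.
    have -> : e = k * (e / (k + 1)) + e / (k + 1).
      by field; rewrite gt_eqF // ltr_wpDl.
    by apply: ler_ltD => //; rewrite ler_wpM2l // ltW.
  by exists (a *: y + z); [rewrite lp|rewrite lq]; apply: aux.
have Gex v : exists w, G v w.
  have /choice[s sP] (n : nat) : exists y, hn (v - p y) < n.+1%:R^-1.
    have n0 : 0 < n.+1%:R^-1 :> R by rewrite invr_gt0.
    by have [_ [y _ <-] h] := dp v _ n0; exists y.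
  have small e : 0 < e -> exists n0, forall n, (n0 <= n)%N -> hn (v - p (s n)) < e.
    move=> e0; have [n _ ne] := near_infty_natSinv_lt (PosNum e0).
    by exists n => k /ne /= h; apply: lt_trans (sP k) h.
  have [w wP] : exists l, forall e, 0 < e -> exists n0 : nat, forall n,
      (n0 <= n)%N -> hn (q (s n) - l) < e.
    apply: hn_complete => e e0.
    have e1 : 0 < e / 2 / (c + 1) by rewrite !divr_gt0.
    have [n0 h] := small _ e1; exists n0 => m n /h hm /h hk.
    rewrite -(lin_sub lq); apply: le_lt_trans (qp _) _; rewrite (lin_sub lp).
    have : hn (p (s m) - p (s n)) < e / (c + 1).
      apply: le_lt_trans (hn_triangle v _ _) _.
      by rewrite hn_distC (splitr e) mulrDl ltrD.
    rewrite ltr_pdivlMr //; have := hn_ge0 (p (s m) - p (s n)).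
    by move: (hn _) => x; nra.
  exists w => e e0; have [n1 h1] := small _ e0; have [n2 h2] := wP _ e0.
  exists (s (maxn n1 n2)); first by rewrite h1 ?leq_maxl.
  by rewrite hn_distC h2 ?leq_maxr.
have Guniq v w w' : G v w -> G v w' -> w = w'.
  move=> G1 G2; have := Gbound _ _ (Glin (-1) _ _ _ _ G1 G2).
  rewrite !scaleN1r !addNr hn0 mulr0 => h; apply/esym/eqP; rewrite -subr_eq0 addrC.
  by apply/eqP/hn0_eq0/eqP; rewrite eq_le hn_ge0 h.
have /choice[T TP] := Gex.
exists T; split=> [|y|v]; last exact: Gbound.
  apply/bounded_opsP; split=> [a u v|]; first by apply: Guniq (Glin _ _ _ _ _ _ _).
  by exists c => // v; apply: Gbound.
apply: Guniq (TP _) _ => e e0; exists y; by rewrite subrr hn0.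
Qed.

Implicit Types (X Y : set (H -> H)).

Lemma commutant_comp X T U : commutant X T -> commutant X U -> commutant X (T \o U).
Proof.
move=> [bT cT] [bU cU]; split; first exact: bounded_comp.
by move=> x Xx; rewrite -compA cU // compA cT.
Qed.

Lemma commutant_linearcomb X a T U : (forall x, X x -> linear x) ->
  commutant X T -> commutant X U -> commutant X (fun v => a *: T v + U v).
Proof.
move=> linX [bT cT] [bU cU]; split; first exact: bounded_linearcomb.
move=> x Xx; apply/funext => v /=; rewrite (linX _ Xx).
by have /funeqP/(_ v) /= -> := cT _ Xx; have /funeqP/(_ v) /= -> := cU _ Xx.
Qed.

Lemma commutant_sub X T U : (forall x, X x -> linear x) ->
  commutant X T -> commutant X U -> commutant X (fun v => T v - U v).
Proof.
move=> linX cT cU; have := commutant_linearcomb (-1) linX cU cT.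
by congr (commutant _ _); apply/funext => v; rewrite scaleN1r addrC.
Qed.

Lemma commutantS X Y : X `<=` Y -> commutant Y `<=` commutant X.
Proof. by move=> XY T [bT cT]; split=> // x /XY; apply: cT. Qed.

Lemma sub_bicommutant X : X `<=` @bounded_ops R H -> X `<=` bicommutant X.
Proof. by move=> bX x Xx; split=> [|y [_ cy]]; [apply: bX|rewrite cy]. Qed.

Lemma commutant_adjoint X T T' :
  (forall x, X x -> exists2 x', X x' & adjoint_ops dot x x') ->
  adjoint_ops dot T T' -> bounded_ops T' -> commutant X T -> commutant X T'.
Proof.
move=> starX TT' bT' [bT cT]; split=> // x Xx.
have [x' Xx' xx'] := starX _ Xx.
have x'x := adjoint_sym xx'; have T'T := adjoint_sym TT'.
apply/funext => v; apply: (dot_inj (dot := dot)) => w /=.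
rewrite -TT' -!x'x -TT'.
by have /funeqP/(_ w) /= -> := cT _ Xx'.
Qed.

(** The adjoint exists by the Riesz theorem and cannot leave the commutant of a
    set closed under adjoints. *)
Lemma commutant_has_adjoints X T :
  (forall x, X x -> exists2 x', X x' & adjoint_ops dot x x') ->
  commutant X T -> exists2 T', commutant X T' & adjoint_ops dot T T'.
Proof.
move=> starX cT; have [T' bT' TT'] := adjoint_exists (proj1 cT).
by exists T' => //; apply: commutant_adjoint cT.
Qed.

(** The bicommutant of [X] is one of the von Neumann algebras containing [X]. *)
Lemma commutant_vn_generated X : X `<=` @bounded_ops R H ->
  (forall T, commutant X T -> exists2 T', commutant X T' & adjoint_ops dot T T') ->
  commutant (vn_generated dot X) = commutant X.
Proof.
move=> bX starX; apply/seteqP; split.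
  by apply: commutantS => x Xx N _; apply.
move=> T cT; split=> [|y]; first by case: cT.
move=> /(_ (bicommutant X)) h; suff [_ /(_ _ cT)] : bicommutant X y by [].
apply: h; last exact: sub_bicommutant.
split.
- by move=> x [].
- by move=> x x' cx bx' xx'; apply: commutant_adjoint cx.
- apply/seteqP; split; last by apply: sub_bicommutant => x [].
  by apply: commutantS; apply: sub_bicommutant => x [].
Qed.

(** Invariance gives [P T P = T P] and [P T' P = T' P], and the adjoint of the
    second identity is [P T P = P T]. *)
Lemma projection_commutes (K : set H) P T T' :
  (forall v, K (P v)) -> (forall v, K v -> P v = v) -> adjoint_ops dot P P ->
  adjoint_ops dot T T' -> (forall v, K v -> K (T v)) ->
  (forall v, K v -> K (T' v)) -> P \o T = T \o P.
Proof.
move=> PK Pid PP TT' KT KT'; apply/funext => v /=.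
apply: (dot_inj (dot := dot)) => w.
rewrite -[T (P v)]Pid; last exact/KT.
rewrite -!PP -(adjoint_sym TT') -(adjoint_sym TT') -PP.
by rewrite (Pid (T' _)) //; apply: KT'.
Qed.

End BoundedOps.

(** * Contractivity of representations of C*-algebras *)

Section CStarBasics.
Variables (R : realType) (A : cstarAlgType R).
Implicit Types (x y z : A) (c e : R) (a : R[i]).

Lemma star0 : star (0 : A) = 0.
Proof. by apply: (addrI (star 0)); rewrite -starD !addr0. Qed.

Lemma starN x : star (- x) = - star x.
Proof. by apply/eqP; rewrite -addr_eq0 -starD addNr star0. Qed.

Lemma starB x y : star (x - y) = star x - star y.
Proof. by rewrite starD starN. Qed.

Lemma star1 : star (1 : A) = 1.
Proof. by rewrite -[LHS]mulr1 -{2}(starK 1) -starM mulr1 starK. Qed.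

Lemma star_sum (I : Type) (r : seq I) (P : pred I) (F : I -> A) :
  star (\sum_(i <- r | P i) F i) = \sum_(i <- r | P i) star (F i).
Proof. by apply: big_morph; [exact: starD|exact: star0]. Qed.

Lemma cnormZr c x : cnorm (c%:C%C *: x) = `|c| * cnorm x.
Proof.
apply: complexI; rewrite cnormZ rmorphM /=; congr (_ * _).
by rewrite normc_def /= expr0n addr0 sqrtr_sqr.
Qed.

Lemma cnorm0 : cnorm (0 : A) = 0.
Proof. by rewrite -(scale0r (0 : A)) -(rmorph0 (real_complex R)) cnormZr normr0 mul0r. Qed.

Lemma cnormN x : cnorm (- x) = cnorm x.
Proof.
by rewrite -scaleN1r -(rmorph1 (real_complex R)) -rmorphN cnormZr normrN1 mul1r.
Qed.

Lemma cnorm_ge0 x : 0 <= cnorm x.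
Proof. by have := cnormD x (- x); rewrite subrr cnorm0 cnormN; lra. Qed.

Lemma cnorm_distC x y : cnorm (x - y) = cnorm (y - x).
Proof. by rewrite -cnormN opprB. Qed.

Lemma cnorm_triangle y x z : cnorm (x - z) <= cnorm (x - y) + cnorm (y - z).
Proof. by rewrite -[x - z](subrKA y) cnormD. Qed.

Lemma cnorm_starE x : cnorm (star x) = cnorm x.
Proof.
have le y : cnorm y <= cnorm (star y).
  have := cnormM (star y) y; rewrite cnorm_star expr2.
  have [->|n0] := eqVneq (cnorm y) 0; first by rewrite cnorm_ge0.
  by rewrite ler_pM2r // lt_def n0 cnorm_ge0.
by apply/eqP; rewrite eq_le le andbT -{2}(starK x) le.
Qed.

Lemma cnorm1_le1 : cnorm (1 : A) <= 1.
Proof.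
have := cnorm_star (1 : A); rewrite star1 mulr1 => h.
have := sqr_ge0 (cnorm (1 : A) - 1); move: h; move: (cnorm _) => c; nra.
Qed.

Lemma cnormX_le x n : cnorm (x ^+ n) <= cnorm x ^+ n.
Proof.
elim: n => [|n IH]; first by rewrite !expr0 cnorm1_le1.
rewrite !exprS; apply: le_trans (cnormM _ _) _.
by rewrite ler_wpM2l ?cnorm_ge0.
Qed.

Lemma cnorm_small_eq0 x : (forall e, 0 < e -> cnorm x <= e) -> x = 0.
Proof.
move=> h; apply: cnorm_eq0; apply/eqP; rewrite eq_le cnorm_ge0 andbT.
by apply/ler_addgt0Pr => e e0; rewrite add0r; apply: h.
Qed.

Lemma expr_lt_eps (q e : R) : 0 <= q -> q < 1 -> 0 < e ->
  exists n0, forall n, (n0 <= n)%N -> q ^+ n < e.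
Proof.
move=> q0 q1 e0; have := @cvg_expr R q; rewrite ger0_norm // => /(_ q1).
move=> /cvgrPdist_lt/(_ _ e0)[n0 _ h]; exists n0 => n /h /=.
by rewrite sub0r normrN ger0_norm // exprn_ge0.
Qed.

(** The left inverse is the sum of the geometric series of [x]. *)
Lemma neumann x : cnorm x < 1 -> exists b, b * (1 - x) = 1.
Proof.
set q := cnorm x => q1; have q0 : 0 <= q by apply: cnorm_ge0.
have p1 : 0 < 1 - q by rewrite subr_gt0.
pose s n := \sum_(i < n) x ^+ i.
have sE n : s n * (1 - x) = 1 - x ^+ n.
  elim: n => [|n IH]; first by rewrite /s big_ord0 mul0r expr0 subrr.
  by rewrite /s big_ord_recr /= mulrDl IH mulrBr mulr1 -exprSr subrKA.
have sB n m : (n <= m)%N -> cnorm (s m - s n) * (1 - q) <= q ^+ n - q ^+ m.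
  elim: m => [|m IH]; first by rewrite leqn0 => /eqP ->; rewrite !subrr cnorm0 mul0r.
  rewrite leq_eqVlt => /orP[/eqP ->|/IH h]; first by rewrite !subrr cnorm0 mul0r.
  rewrite /s big_ord_recr /= addrAC -/(s m) -/(s n).
  have h1 := cnormD (s m - s n) (x ^+ m); have h2 := cnormX_le x m.
  rewrite exprSr; move: h h1 h2; rewrite -/q; move: (cnorm _) (cnorm _) (cnorm _).
  by move=> u v w; nra.
have [l lP] : exists l, (fun n => cnorm (s n - l)) @ \oo --> (0 : R).
  apply: cnorm_complete => e e0; have e1 : 0 < e * (1 - q) by rewrite mulr_gt0.
  have [n0 h0] := expr_lt_eps q0 q1 e1; exists n0.
  have aux n m : (n0 <= n)%N -> (n <= m)%N -> cnorm (s m - s n) < e.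
    move=> hn /sB; rewrite -(ltr_pM2r p1) => /le_lt_trans; apply.
    by apply: le_lt_trans (h0 _ hn); rewrite gerBl exprn_ge0.
  move=> m n hm hn; have [nm|/ltnW mn] := leqP n m; first exact: aux.
  by rewrite cnorm_distC aux.
exists l; apply/eqP; rewrite -subr_eq0; apply/eqP/cnorm_small_eq0 => e e0.
pose t := cnorm (1 - x); have t0 : 0 <= t by apply: cnorm_ge0.
have e1 : 0 < e / (2 * (t + 1)) by rewrite divr_gt0 // mulr_gt0 // ltr_wpDl.
have [n1 h1] := expr_lt_eps q0 q1 (divr_gt0 e0 (ltr0Sn _ 1)).
move/cvgrPdist_lt: lP => /(_ _ e1)[n2 _ h2].
pose n := maxn n1 n2.
have {}h1 := h1 n (leq_maxl _ _); have {h2} /= h2 := h2 n (leq_maxr _ _).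
rewrite sub0r normrN ger0_norm ?cnorm_ge0 // in h2.
have -> : l * (1 - x) - 1 = - ((s n - l) * (1 - x)) - x ^+ n.
  by rewrite mulrBl sE; rewrite opprB -addrA; congr (_ + _); rewrite opprB addrAC subrr sub0r.
apply: le_trans (cnormD _ _) _; rewrite !cnormN.
have h3 := cnormM (s n - l) (1 - x); have h4 := cnormX_le x n.
rewrite -/t -/q in h3 h4.
have h5 : cnorm (s n - l) * t <= e / 2.
  apply: (@le_trans _ _ (e / (2 * (t + 1)) * t)); first by rewrite ler_wpM2r // ltW.
  rewrite invfM mulrA -mulrA ler_piMr ?divr_ge0 ?(ltW e0) //.
  by rewrite mulrC ler_pdivrMr ?ltr_wpDl // mul1r lerDl.
by lra.
Qed.

End CStarBasics.

Section Contractive.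
Variables (R : realType) (A : cstarAlgType R) (H : completeNormedModType R[i]).
Variable dot : {dot H for Num.conj}.
Hypothesis dotP : is_hilbert_dot dot.
Variable rho : A -> H -> H.
Hypothesis rhoP : is_representation dot rho.
Implicit Types (x y : A) (v w : H).

Lemma repD x y v : rho (x + y) v = rho x v + rho y v.
Proof. by rewrite -[x]scale1r (rep_linear rhoP) !scale1r. Qed.
Lemma rep0 v : rho 0 v = 0.
Proof. by apply: (addrI (rho 0 v)); rewrite -repD !addr0. Qed.
Lemma repZ a x v : rho (a *: x) v = a *: rho x v.
Proof. by rewrite -[a *: x]addr0 (rep_linear rhoP) rep0 addr0. Qed.
Lemma repB x y v : rho (x - y) v = rho x v - rho y v.
Proof. by rewrite repD -scaleN1r repZ scaleN1r. Qed.
Lemma repM x y v : rho (x * y) v = rho x (rho y v).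
Proof. by rewrite (rep_mul rhoP). Qed.
Lemma rep1 v : rho 1 v = v.
Proof. by rewrite (rep_unit rhoP). Qed.
Lemma rep_sum (I : Type) (r : seq I) (F : I -> A) v :
  rho (\sum_(i <- r) F i) v = \sum_(i <- r) rho (F i) v.
Proof. by apply: (big_morph (rho^~ v)) => [x y|]; [exact: repD|exact: rep0]. Qed.
Lemma rep_lin x : linear (rho x).
Proof. exact: (bounded_lin (rep_bounded rhoP x)). Qed.
Lemma rep_rdot x v w : rdot dot (rho x v) w = rdot dot v (rho (star x) w).
Proof. by rewrite /rdot (rep_star rhoP). Qed.

(** The best bound [c] of a self-adjoint [T = rho h] cannot be at least [1] if
    [cnorm h < 1]: otherwise [1 - h^2/c^2] is invertible, so that [1 - T^2/c^2]
    is bounded below, and this improves the bound [c]. *)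
Lemma rep_contractive_selfadjoint h v : star h = h -> cnorm h < 1 ->
  hn (rho h v) <= hn v.
Proof.
move=> hsa h1; have h0 := cnorm_ge0 h.
pose E := [set c : R | 0 <= c /\ forall v, hn (rho h v) <= c * hn v].
have /bounded_opsP[_ [c' c'0 bT]] := rep_bounded rhoP h.
have hasE : has_inf E by split; [exists c'|exists 0 => c []].
set c := inf E.
have Ec : E c.
  split; first by apply: lb_le_inf; [case: hasE|move=> c1 []].
  move=> w; apply/ler_addgt0Pr => e e0.
  have e1 : 0 < e / (hn w + 1) by rewrite divr_gt0 // ltr_wpDl // hn_ge0.
  have [c1 [_ b1] lt1] := inf_adherent e1 hasE.
  apply: le_trans (b1 w) _; apply: le_trans (ler_wpM2r (hn_ge0 w) (ltW lt1)) _.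
  rewrite mulrDl lerD2l mulrAC ler_pdivrMr ?ltr_wpDl ?hn_ge0 //.
  by rewrite ler_wpM2l ?(ltW e0) // lerDl.
have [c0 cT] := Ec.
have [|c1] := leP c 1.
  move=> cl1; apply: le_trans (cT v) _.
  by rewrite ler_piMl ?hn_ge0.
exfalso.
pose k := ((c ^- 2)%:C)%C *: (h * h).
have ci : 0 < c ^- 2 by rewrite invr_gt0 exprn_gt0 // (lt_trans _ c1).
have ci1 : c ^- 2 < 1 by rewrite invf_lt1 ?exprn_gt0 ?(lt_trans _ c1) // exprn_egt1.
have k1 : cnorm k < 1.
  rewrite cnormZr gtr0_norm //; have := cnormM h h; move: (cnorm (h * h)) => y.
  move: (cnorm h) h0 h1 => z z0 z1 yz.
  have : y < 1 by nra.
  move: ci ci1; move: (c ^- 2) => u; nra.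
have [b bk] := neumann k1.
have /bounded_opsP[_ [be' be'0 bb]] := rep_bounded rhoP b.
pose be := be' + 1.
have be1 : 1 <= be by rewrite lerDr.
have low w : hn w ^+ 2 <= be ^+ 2 * (hn w ^+ 2 - c ^- 2 * hn (rho h w) ^+ 2).
  have h2 : hn (w - (c ^- 2)%:C%C *: rho h (rho h w)) ^+ 2 <=
      hn w ^+ 2 - c ^- 2 * hn (rho h w) ^+ 2.
    rewrite (hn_sqrB dotP) rdotZr hnZr gtr0_norm // exprMn.
    have -> : rdot dot w (rho h (rho h w)) = hn (rho h w) ^+ 2.
      by rewrite -(rdot_hn dotP) rep_rdot hsa.
    have h3 : hn (rho h (rho h w)) ^+ 2 <= c ^+ 2 * hn (rho h w) ^+ 2.
      by rewrite -exprMn ler_pXn2r ?nnegrE ?mulr_ge0 ?hn_ge0.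
    have h4 : c ^- 2 ^+ 2 * hn (rho h (rho h w)) ^+ 2 <= c ^- 2 * hn (rho h w) ^+ 2.
      apply: le_trans (ler_wpM2l (exprn_ge0 2 (ltW ci)) h3) _.
      rewrite mulrA expr2 -(mulrA (c ^- 2)) mulVf ?mulr1 //.
      by rewrite gt_eqF // exprn_gt0 // (lt_trans _ c1).
    lra.
  have h5 : hn w <= be * hn (w - (c ^- 2)%:C%C *: rho h (rho h w)).
    have {1}-> : w = rho b (w - (c ^- 2)%:C%C *: rho h (rho h w)).
      by rewrite -[LHS]rep1 -bk repM repB rep1 repZ repM.
    by apply: le_trans (bb _) _; rewrite ler_wpM2r ?hn_ge0 // lerDl.
  apply: le_trans (_ : (be * hn (w - (c ^- 2)%:C%C *: rho h (rho h w))) ^+ 2 <= _).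
    by rewrite ler_pXn2r ?nnegrE ?mulr_ge0 ?hn_ge0 // (le_trans _ be1).
  by rewrite exprMn ler_wpM2l // exprn_ge0 // (le_trans _ be1).
have be0 : 0 < be by apply: lt_le_trans be1.
have c0' : 0 < c by apply: lt_trans c1.
pose m := c ^+ 2 * (1 - be ^- 2).
have m0 : 0 <= m.
  by rewrite mulr_ge0 ?exprn_ge0 // subr_ge0 invf_le1 ?exprn_gt0 // exprn_ege1.
have Em : E (Num.sqrt m).
  split; first exact: sqrtr_ge0.
  move=> w; rewrite -(@ler_pXn2r _ 2) ?nnegrE ?mulr_ge0 ?hn_ge0 ?sqrtr_ge0 //.
  rewrite exprMn sqr_sqrtr //.
  have h1' : be ^- 2 * hn w ^+ 2 <= hn w ^+ 2 - c ^- 2 * hn (rho h w) ^+ 2.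
    by rewrite mulrC ler_pdivrMr ?exprn_gt0 // mulrC.
  have h2' : c ^- 2 * hn (rho h w) ^+ 2 <= (1 - be ^- 2) * hn w ^+ 2 by lra.
  by move: h2'; rewrite mulrC ler_pdivrMr ?exprn_gt0 // => /le_trans; apply; rewrite /m; lra.
have : c <= Num.sqrt m by apply: ge_inf Em; case: hasE.
rewrite leNgt => /negP; apply.
rewrite -(@ltr_pXn2r _ 2) ?nnegrE ?sqrtr_ge0 // sqr_sqrtr // /m.
by rewrite gtr_pMr ?exprn_gt0 // gtrBl invr_gt0 exprn_gt0.
Qed.

(** By the C*-identity it suffices to treat the self-adjoint element [x^* x],
    rescaled to norm less than [1]. *)
Lemma rep_contractive x v : hn (rho x v) <= cnorm x * hn v.
Proof.
apply/ler_addgt0Pr => e e0.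
have x0 := cnorm_ge0 x; have v0 := hn_ge0 v.
pose s := cnorm x + e / (hn v + 1).
have e1 : 0 < e / (hn v + 1) by rewrite divr_gt0 // ltr_wpDl.
have xs : cnorm x < s by rewrite ltrDl.
have s0 : 0 < s by apply: le_lt_trans xs.
have sv : s * hn v <= cnorm x * hn v + e.
  rewrite /s mulrDl lerD2l mulrAC ler_pdivrMr ?ltr_wpDl //.
  by rewrite ler_wpM2l ?(ltW e0) // lerDl.
apply: le_trans sv.
pose h := ((s ^- 2)%:C)%C *: (star x * x).
have hsa : star h = h by rewrite starZ starM starK conjc_real.
have si : 0 < s ^- 2 by rewrite invr_gt0 exprn_gt0.
have h1 : cnorm h < 1.
  rewrite cnormZr gtr0_norm // cnorm_star mulrC ltr_pdivrMr ?exprn_gt0 // mul1r.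
  by rewrite ltr_pXn2r ?nnegrE // ltW.
rewrite -(@ler_pXn2r _ 2) ?nnegrE ?mulr_ge0 ?hn_ge0 ?(ltW s0) //.
have -> : hn (rho x v) ^+ 2 = s ^+ 2 * rdot dot (rho h v) v.
  rewrite repZ rdotZl mulrA divff ?mul1r ?gt_eqF ?exprn_gt0 //.
  by rewrite repM rep_rdot starK (rdot_hn dotP).
rewrite exprMn ler_wpM2l ?exprn_ge0 ?(ltW s0) //.
apply: le_trans (rdot_le dotP _ _) _.
by rewrite expr2 ler_wpM2r // rep_contractive_selfadjoint.
Qed.

End Contractive.

(** * Words in the generators of the Cuntz algebra *)

Section Span.
Variables (R : realType) (A : cstarAlgType R).
Implicit Types (X Y Z : set A) (x y z : A) (a : R[i]).

(** The linear span, in the form whose induction principle reduces a linear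
    property to the elements of [X]. *)
Inductive span X : A -> Prop :=
| span_0 : span X 0
| span_step a x y : X x -> span X y -> span X (a *: x + y).

Lemma span_lin X a x y : span X x -> span X y -> span X (a *: x + y).
Proof.
move=> sx sy; elim: sx a => [|b z x' Xz _ IH] a; first by rewrite scaler0 add0r.
by rewrite scalerDr scalerA -addrA; apply: span_step.
Qed.

Lemma span_mem X x : X x -> span X x.
Proof.
by move=> Xx; rewrite -[x]addr0 -[x]scale1r; apply: span_step => //; apply: span_0.
Qed.

Lemma spanD X x y : span X x -> span X y -> span X (x + y).
Proof. by move=> sx sy; rewrite -[x]scale1r; apply: span_lin. Qed.

Lemma spanZ X a x : span X x -> span X (a *: x).
Proof. by move=> sx; rewrite -[_ *: _]addr0; apply: span_lin => //; apply: span_0. Qed.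

Lemma span_sum X (I : Type) (r : seq I) (F : I -> A) :
  (forall i, span X (F i)) -> span X (\sum_(i <- r) F i).
Proof.
move=> sF; elim: r => [|i r IH]; first by rewrite big_nil; apply: span_0.
by rewrite big_cons; apply: spanD.
Qed.

Lemma span_sub X (P : set A) : P 0 ->
  (forall a x y, P x -> P y -> P (a *: x + y)) -> X `<=` P -> span X `<=` P.
Proof. by move=> P0 Plin XP x; elim=> // a {}x y /XP; auto. Qed.

Lemma span_map X Y (f : A -> A) x : linear f ->
  (forall x, X x -> span Y (f x)) -> span X x -> span Y (f x).
Proof.
move=> lf h; apply: (@span_sub X [set x | span Y (f x)]) => //=.
  by rewrite (lin_0 lf); apply: span_0.
by move=> a u v su sv; rewrite lf; apply: span_lin.
Qed.

Lemma mull_lin z : linear (fun x : A => z * x).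
Proof. by move=> a x y; rewrite mulrDr scalerAr. Qed.
Lemma mulr_lin z : linear (fun x : A => x * z).
Proof. by move=> a x y; rewrite mulrDl scalerAl. Qed.
Lemma mullr_lin y z : linear (fun x : A => y * x * z).
Proof. by move=> a u v; rewrite mull_lin mulr_lin. Qed.

Lemma span_mul X Y Z x y : (forall x y, X x -> Y y -> span Z (x * y)) ->
  span X x -> span Y y -> span Z (x * y).
Proof.
move=> h sx sy; apply: (span_map (mulr_lin y) _ sx) => {sx}x Xx.
by apply: (span_map (mull_lin x) _ sy) => {sy}y Yy; apply: h.
Qed.

Lemma span_star X Y x : (forall x, X x -> span Y (star x)) ->
  span X x -> span Y (star x).
Proof.
move=> h; elim=> [|a u v Xu _ IH]; first by rewrite star0; apply: span_0.
by rewrite starD starZ; apply: span_lin => //; apply: h.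
Qed.

Lemma sub_cclosure X : X `<=` cclosure X.
Proof. by move=> x Xx e e0; exists x => //; rewrite subrr cnorm0. Qed.

Lemma cclosure_map X Y (f : A -> A) c x : linear f ->
  (forall x, cnorm (f x) <= c * cnorm x) ->
  (forall x, X x -> Y (f x)) -> cclosure X x -> cclosure Y (f x).
Proof.
move=> lf bf XY cx e e0.
have c0 : 0 < `|c| + 1 by rewrite ltr_wpDl.
have [y Xy xy] := cx _ (divr_gt0 e0 c0); exists (f y); first exact: XY.
rewrite -(lin_sub lf); apply: le_lt_trans (bf _) _.
move: xy; rewrite ltr_pdivlMr //; have := cnorm_ge0 (x - y).
by move: (cnorm _) (ler_norm c) => t; nra.
Qed.

Lemma cclosure_star X x : (forall x, X x -> X (star x)) ->
  cclosure X x -> cclosure X (star x).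
Proof.
move=> Xs cx e /cx[y Xy xy]; exists (star y); first exact: Xs.
by rewrite -starB cnorm_starE.
Qed.

Lemma cclosure_idem X : cclosure (cclosure X) `<=` cclosure X.
Proof.
move=> x cx e e0; have e2 : 0 < e / 2 by rewrite divr_gt0.
have [y /(_ _ e2)[z Xz yz] xy] := cx _ e2; exists z => //.
by apply: le_lt_trans (cnorm_triangle y _ _) _; rewrite (splitr e) ltrD.
Qed.

Lemma cclosureD X x y : (forall x y, X x -> X y -> X (x + y)) ->
  cclosure X x -> cclosure X y -> cclosure X (x + y).
Proof.
move=> XD cx cy e e0; have e2 : 0 < e / 2 by rewrite divr_gt0.
have [x' Xx xx] := cx _ e2; have [y' Xy yy] := cy _ e2.
exists (x' + y'); first exact: XD.
rewrite opprD addrACA; apply: le_lt_trans (cnormD _ _) _.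
by rewrite (splitr e) ltrD.
Qed.

Lemma cclosureM X x y : (forall x y, X x -> X y -> X (x * y)) ->
  cclosure X x -> cclosure X y -> cclosure X (x * y).
Proof.
move=> XM cx cy; apply: cclosure_idem.
apply: (@cclosure_map X _ (fun x => x * y) (cnorm y)) => //.
- exact: mulr_lin.
- by move=> z; rewrite (mulrC (cnorm y)) cnormM.
move=> {cx}x Xx; apply: (@cclosure_map X _ (fun y => x * y) (cnorm x)) => //.
- exact: mull_lin.
- by move=> z; rewrite cnormM.
by move=> z; apply: XM.
Qed.

Lemma cclosureZ X a x : (forall x, X x -> X (a *: x)) ->
  cclosure X x -> cclosure X (a *: x).
Proof.
move=> XZ; apply: (@cclosure_map X _ (fun x => a *: x) (complex.Re `|a|)) => //.
  by move=> b u v; rewrite scalerDr !scalerA mulrC.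
move=> z; rewrite -lecR cnormZ rmorphM -[X in X * _](@RRe_real R `|a|) ?normr_real //.
Qed.

Lemma cclosure_closed_subalgebra (B : set A) : B 1 ->
  (forall a x y, B x -> B y -> B (a *: x + y)) ->
  (forall x y, B x -> B y -> B (x * y)) -> (forall x, B x -> B (star x)) ->
  closed_star_subalgebra (cclosure B).
Proof.
move=> B1 Blin BM Bs.
have B0 : B 0 by rewrite -(addNr (1 : A)) -scaleN1r; apply: Blin.
split.
- exact: sub_cclosure.
- move=> a x y cx cy; apply: cclosureD => //.
    by move=> u v Bu Bv; rewrite -[u]scale1r; apply: Blin.
  by apply: cclosureZ cx => u Bu; rewrite -[_ *: _]addr0; apply: Blin.
- by move=> x y; apply: cclosureM.
- by move=> x; apply: cclosure_star.
- exact: cclosure_idem.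
Qed.

End Span.

Section Words.
Variables (R : realType) (d : nat) (A : cstarAlgType R) (S : 'I_d -> A).
Hypothesis A_cuntz : is_cuntz_algebra S.
Implicit Types (x y z : A) (mu nu : seq 'I_d) (a : R[i]).

Definition word mu : A := \prod_(i <- mu) S i.

Lemma word_nil : word [::] = 1. Proof. by rewrite /word big_nil. Qed.
Lemma word_cons i mu : word (i :: mu) = S i * word mu.
Proof. by rewrite /word big_cons. Qed.
Lemma word_cat mu nu : word (mu ++ nu) = word mu * word nu.
Proof. by rewrite /word big_cat. Qed.
Lemma word_rcons mu i : word (rcons mu i) = word mu * S i.
Proof. by rewrite -cats1 word_cat word_cons word_nil mulr1. Qed.

Definition monomial mu nu : A := word mu * star (word nu).

Lemma star_monomial mu nu : star (monomial mu nu) = monomial nu mu.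
Proof. by rewrite starM starK. Qed.

Lemma star_gen_mul i j x : star (S i) * (S j * x) = (i == j)%:R * x.
Proof. by rewrite mulrA (cuntz_orth A_cuntz). Qed.

(** Two words cancel until one of them is exhausted, unless they differ at some
    common position, which gives [0]. *)
Lemma word_reduce nu mu : star (word nu) * word mu = 0 \/
  exists g, (mu = nu ++ g /\ star (word nu) * word mu = word g) \/
            (nu = mu ++ g /\ star (word nu) * word mu = star (word g)).
Proof.
elim: nu mu => [|i nu IH] mu.
  by right; exists mu; left; rewrite word_nil star1 mul1r.
case: mu => [|j mu].
  by right; exists (i :: nu); right; rewrite word_nil mulr1.
rewrite !word_cons starM -mulrA star_gen_mul.
have [<-|_] := eqVneq i j; last by left; rewrite mul0r mulr0.
rewrite mul1r; case: (IH mu) => [->|[g [[-> ->]|[-> ->]]]]; first by left.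
  by right; exists g; left.
by right; exists g; right.
Qed.

Lemma word_orth mu nu : size mu = size nu ->
  star (word mu) * word nu = (mu == nu)%:R.
Proof.
elim: mu nu => [|i mu IH] [|j nu] //=; first by rewrite word_nil star1 mulr1.
move=> [/IH h]; rewrite !word_cons starM -mulrA star_gen_mul eqseq_cons.
by have [_|_] := eqVneq i j; rewrite ?mul0r ?mulr0 // mul1r.
Qed.

Definition monomials : set A := [set x | exists mu nu, x = monomial mu nu].
Definition core_monomials n : set A :=
  [set x | exists mu nu, [/\ size mu = n, size nu = n & x = monomial mu nu]].

Lemma span_monomials_star x : span monomials x -> span monomials (star x).
Proof.
apply: span_star => _ [mu [nu ->]]; rewrite star_monomial.
by apply: span_mem; exists nu, mu.
Qed.

Lemma span_core_star n x : span (core_monomials n) x -> span (core_monomials n) (star x).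
Proof.
apply: span_star => _ [mu [nu [hm hn ->]]]; rewrite star_monomial.
by apply: span_mem; exists nu, mu.
Qed.

Lemma span_monomialsM x y : span monomials x -> span monomials y -> span monomials (x * y).
Proof.
apply: span_mul => _ _ [mu [nu ->]] [al [be ->]].
rewrite /monomial mulrA -(mulrA (word mu)).
case: (word_reduce nu al) => [->|[g [[_ ->]|[_ ->]]]].
- by rewrite mulr0 mul0r; apply: span_0.
- by rewrite -word_cat; apply: span_mem; exists (mu ++ g), be.
- by rewrite -mulrA -starM -word_cat; apply: span_mem; exists mu, (be ++ g).
Qed.

Lemma monomial_orth mu nu al be : size nu = size al ->
  monomial mu nu * monomial al be = (nu == al)%:R *: monomial mu be.
Proof.
move=> h; rewrite /monomial mulrA -(mulrA (word mu)) word_orth //.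
by have [_|_] := eqVneq nu al; rewrite ?mulr1 ?scale1r // mulr0 mul0r scale0r.
Qed.

Lemma span_coreM n x y : span (core_monomials n) x -> span (core_monomials n) y ->
  span (core_monomials n) (x * y).
Proof.
apply: span_mul => _ _ [mu [nu [hm hn ->]]] [al [be [ha hb ->]]].
by rewrite monomial_orth ?hn //; apply: spanZ; apply: span_mem; exists mu, be.
Qed.

(** The inclusion of the [n]-th matrix algebra of the core in the next one. *)
Lemma monomial_expand mu nu : monomial mu nu = \sum_i monomial (rcons mu i) (rcons nu i).
Proof.
rewrite /monomial -[word mu in LHS]mulr1 -(cuntz_sum A_cuntz) mulr_sumr mulr_suml.
by apply: eq_bigr => i _; rewrite !word_rcons starM !mulrA.
Qed.

Lemma span_coreS n x : span (core_monomials n) x -> span (core_monomials n.+1) x.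
Proof.
apply: (@span_map _ _ _ _ id) => // _ [mu [nu [hm hn ->]]].
rewrite monomial_expand; apply: span_sum => i; apply: span_mem.
by exists (rcons mu i), (rcons nu i); rewrite !size_rcons hm hn.
Qed.

Lemma span_core_le m n x : (m <= n)%N ->
  span (core_monomials m) x -> span (core_monomials n) x.
Proof.
move=> /subnKC <-; elim: (n - m)%N x => [|k IH] x; first by rewrite addn0.
by rewrite addnS => /IH /span_coreS.
Qed.

Lemma core_monomials_sub n : core_monomials n `<=` monomials.
Proof. by move=> _ [mu [nu [_ _ ->]]]; exists mu, nu. Qed.

Lemma span_core_monomials n x : span (core_monomials n) x -> span monomials x.
Proof. by apply: (@span_map _ _ _ _ id) => // y /core_monomials_sub; apply: span_mem. Qed.

Lemma span_core1 n : span (core_monomials n) 1.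
Proof.
apply: (@span_core_le 0) => //; apply: span_mem; exists [::], [::]; split => //.
by rewrite /monomial word_nil star1 mulr1.
Qed.

(** The closure of the span of the monomials is a C*-subalgebra containing the
    generators. *)
Lemma span_monomials_dense x : cclosure (span monomials) x.
Proof.
have := @cuntz_gen _ _ _ _ A_cuntz (cclosure (span monomials)).
move=> -> //; first apply: cclosure_closed_subalgebra.
- exact: (span_core_monomials (span_core1 0)).
- exact: span_lin.
- exact: span_monomialsM.
- exact: span_monomials_star.
- move=> i; apply: sub_cclosure; apply: span_mem; exists [:: i], [::].
  by rewrite /monomial word_cons !word_nil star1 !mulr1.
Qed.

Lemma Fn_span n : Fn S n = span (core_monomials n).
Proof.
apply/seteqP; split=> x.
  move=> [c ->]; apply: span_sum => mu; apply: span_sum => nu; apply: spanZ.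
  by apply: span_mem; exists mu, nu; rewrite !size_tuple.
apply: span_sub.
- exists (fun _ _ => 0); apply/esym; rewrite big1 // => mu _; rewrite big1 // => nu _.
  by rewrite scale0r.
- move=> a _ _ [c ->] [c' ->]; exists (fun m n => a * c m n + c' m n).
  rewrite scaler_sumr -big_split; apply: eq_bigr => mu _ /=.
  rewrite scaler_sumr -big_split; apply: eq_bigr => nu _ /=.
  by rewrite scalerDl scalerA.
move=> _ [mu [nu [/eqP hm /eqP hn ->]]].
pose mu' := Tuple hm; pose nu' := Tuple hn.
exists (fun m n => ((m == mu') && (n == nu'))%:R).
rewrite (bigD1 mu') //= (bigD1 nu') //= !eqxx scale1r.
rewrite big1 => [|n' /negPf ->]; last by rewrite scale0r.
rewrite addr0 big1 ?addr0 // => m' /negPf ->; rewrite big1 // => n' _.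
by rewrite scale0r.
Qed.

Lemma Fd_span : Fd S = cclosure [set x | exists n, span (core_monomials n) x].
Proof.
rewrite /Fd; congr cclosure; apply/seteqP; split=> x.
  by move=> [n _]; rewrite Fn_span; exists n.
by move=> [n sx]; exists n => //; rewrite Fn_span.
Qed.

Lemma Fd_core n x : span (core_monomials n) x -> Fd S x.
Proof. by move=> sx; rewrite Fd_span; apply: sub_cclosure; exists n. Qed.

Lemma Fd_star x : Fd S x -> Fd S (star x).
Proof.
rewrite Fd_span; apply: cclosure_star => y [n sy]; exists n.
exact: span_core_star.
Qed.

Lemma core_corner n i j x : span (core_monomials n.+1) x ->
  span (core_monomials n) (star (S i) * x * S j).
Proof.
apply: (span_map (mullr_lin _ _)) => _ [[|k mu] [[|l nu] [//= [hm] [hn] ->]]].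
rewrite /monomial !word_cons starM !mulrA (cuntz_orth A_cuntz).
rewrite -(mulrA _ (star (S l))) (cuntz_orth A_cuntz).
have [_|_] := eqVneq i k; last by rewrite !mul0r; apply: span_0.
have [_|_] := eqVneq l j; last by rewrite mulr0; apply: span_0.
by rewrite mulr1 mul1r; apply: span_mem; exists mu, nu.
Qed.

Lemma Fd_corner i j x : Fd S x -> Fd S (star (S i) * x * S j).
Proof.
rewrite Fd_span.
apply: (@cclosure_map _ _ _ _ (fun x => star (S i) * x * S j)
          (cnorm (star (S i)) * cnorm (S j))).
- exact: mullr_lin.
- move=> y; apply: le_trans (cnormM _ _) _; rewrite mulrAC ler_wpM2r ?cnorm_ge0 //.
  exact: cnormM.
- by move=> y [n /span_coreS sy]; exists n; apply: core_corner.
Qed.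

Local Notation phi := (canonical_endo S).

Lemma phi_gen x i : phi x * S i = S i * x.
Proof.
rewrite /canonical_endo mulr_suml (bigD1 i) //= -mulrA (cuntz_orth A_cuntz).
rewrite eqxx mulr1 big1 ?addr0 // => j /negPf ji.
by rewrite -mulrA (cuntz_orth A_cuntz) ji mulr0.
Qed.

Lemma phi_star x : phi (star x) = star (phi x).
Proof.
by rewrite /canonical_endo star_sum; apply: eq_bigr => i _; rewrite !starM starK mulrA.
Qed.

Lemma gen_phi x i : star (S i) * phi x = x * star (S i).
Proof. by rewrite -[LHS]starK starM starK -phi_star phi_gen starM starK. Qed.

Lemma phiM x y : phi (x * y) = phi x * phi y.
Proof.
rewrite /canonical_endo mulr_sumr; apply: eq_bigr => i _.
by rewrite !mulrA phi_gen.
Qed.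

Lemma phi1 : phi 1 = 1.
Proof.
rewrite /canonical_endo -[RHS](cuntz_sum A_cuntz); apply: eq_bigr => i _.
by rewrite mulr1.
Qed.

Lemma phi_lin : linear phi.
Proof.
move=> a x y; rewrite /canonical_endo scaler_sumr -big_split.
by apply: eq_bigr => i _ /=; rewrite mullr_lin.
Qed.

Lemma phi_core n x : span (core_monomials n) x -> span (core_monomials n.+1) (phi x).
Proof.
apply: (span_map phi_lin) => _ [mu [nu [hm hn ->]]].
apply: span_sum => i; apply: span_mem; exists (i :: mu), (i :: nu).
by rewrite /= hm hn /monomial !word_cons starM !mulrA.
Qed.

End Words.

(** * The trace composed with the gauge expectation, on words *)

Section UnitCircle.
Variable R : realType.
Implicit Types (s t : R).

Definition expi t : R[i] := (cos t +i* sin t)%C.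

Lemma expiD s t : expi (s + t) = expi s * expi t.
Proof. by rewrite /expi cosD sinD /=; apply/eqP; rewrite eq_complex /= eqxx /= addrC. Qed.

Lemma expi0 : expi 0 = 1.
Proof. by rewrite /expi cos0 sin0. Qed.

Lemma expiX t n : expi t ^+ n = expi (t *+ n).
Proof. by elim: n => [|n IH]; rewrite ?expr0 ?mulr0n ?expi0 // exprS mulrS expiD IH. Qed.

Lemma expi_conj t : expi t * (expi t)^*%C = 1.
Proof.
rewrite -sqr_normc normc_def /= cos2Dsin2 sqrtr1 -rmorphXn /= expr1n.
by rewrite rmorph1.
Qed.

Lemma expi_2pi : expi (2 * pi) = 1.
Proof. by rewrite /expi mulrC mulr_natr cos2pi sin2pi. Qed.

(** A geometric sum of ratio a root of unity; the bound on [n] keeps the angle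
    of this ratio in the open upper half circle, so that it is not [1]. *)
Lemma sum_expi_pow m n : (0 < m)%N -> (2 * m < n)%N ->
  \sum_(k < n) expi (2 * pi * k%:R / n%:R) ^+ m = 0.
Proof.
move=> m0 mn; have n0 : (0 < n)%N by apply: leq_ltn_trans mn.
have nz : n%:R != 0 :> R by rewrite pnatr_eq0 -lt0n.
set q := expi (2 * pi * m%:R / n%:R).
have q1 : q != 1.
  apply/eqP => /(congr1 (@complex.Im R)) /= /eqP; apply/negP; rewrite gt_eqF //.
  apply: sin_gt0_pi; rewrite divr_gt0 ?mulr_gt0 ?pi_gt0 ?ltr0n //=.
  rewrite ltr_pdivrMr ?ltr0n // mulrAC mulrC ltr_pM2l ?pi_gt0 //.
  by rewrite -natrM ltr_nat.
have -> : \sum_(k < n) expi (2 * pi * k%:R / n%:R) ^+ m = \sum_(k < n) q ^+ k.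
  apply: eq_bigr => k _; rewrite !expiX; congr expi.
  by rewrite -[LHS]mulr_natr -[RHS]mulr_natr; field.
apply/eqP; have : (q - 1) * \sum_(k < n) q ^+ k == 0.
  rewrite -subrX1 /q expiX.
  have -> : 2 * pi * m%:R / n%:R *+ n = 2 * pi *+ m :> R.
    by rewrite -[LHS]mulr_natr -[RHS]mulr_natr; field.
  by rewrite -expiX expi_2pi expr1n subrr.
by rewrite mulf_eq0 subr_eq0 (negPf q1).
Qed.

End UnitCircle.

Section State.
Variables (R : realType) (d : nat) (A : cstarAlgType R) (S : 'I_d -> A).
Hypothesis A_cuntz : is_cuntz_algebra S.
Hypothesis d_gt0 : (0 < d)%N.
Implicit Types (x y z : A) (mu nu : seq 'I_d) (a : R[i]).
Variable lambda : A -> A -> A.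
Hypothesis lambdaP : is_lambda S lambda.

Lemma unitary_expi t : unitary (expi t *: (1 : A)).
Proof.
by rewrite /unitary starZ star1 -!scalerAl !mul1r !scalerA (mulrC _^*%C) expi_conj scale1r.
Qed.

Lemma gauge_word t mu :
  lambda (expi t *: 1) (word S mu) = expi t ^+ size mu *: word S mu.
Proof.
have [[_ lM l1 _] lS] := lambdaP (unitary_expi t).
elim: mu => [|i mu IH]; first by rewrite word_nil l1 scale1r.
by rewrite !word_cons lM lS IH exprS -!scalerAl mul1r -scalerAr scalerA.
Qed.

Lemma gauge_monomial t mu nu : lambda (expi t *: 1) (monomial S mu nu) =
  (expi t ^+ size mu * (expi t ^+ size nu)^*%C) *: monomial S mu nu.
Proof.
have [[_ lM _ lstar] _] := lambdaP (unitary_expi t).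
by rewrite lM lstar !gauge_word starZ -scalerAl -scalerAr scalerA.
Qed.

(** The integral is identified by the Riemann sums of the partitions of the
    circle into [n] equal arcs, which are exact for large [n] in the case of
    characters. *)
Lemma riemann_homogeneous (f : R -> A) (g : R -> R[i]) x I (c : R[i]) N :
  is_riemann_integral f 0 (2 * pi) I -> (forall t, f t = g t *: x) ->
  (forall n, (N < n)%N ->
    \sum_(k < n) g (2 * pi * k%:R / n%:R) = n%:R * c) ->
  I = ((2 * pi)%:C%C * c) *: x.
Proof.
move=> fI fg sg; apply/eqP; rewrite -subr_eq0; apply/eqP/cnorm_small_eq0 => e e0.
have p0 : 0 < 2 * pi :> R by rewrite mulr_gt0 ?pi_gt0.
have [de de0 h] := fI _ e0.
have [n1 _ hn1] := near_infty_natSinv_lt (PosNum (divr_gt0 de0 p0)).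
pose n := (maxn N n1).+1.
have nz : n%:R != 0 :> R by rewrite pnatr_eq0.
have n1n : n%:R^-1 < de / (2 * pi) by apply: (hn1 (maxn N n1)); apply: leq_maxr.
pose p (k : nat) : R := 2 * pi * k%:R / n%:R.
have pS k : p k.+1 - p k = 2 * pi / n%:R by rewrite /p -natr1; field.
have p_0 : p 0%N = 0 by rewrite /p mulr0 mul0r.
have p_n : p n = 2 * pi by rewrite /p mulfK.
have tags k : (k < n)%N -> [/\ p k <= p k, p k <= p k.+1 & p k.+1 - p k < de].
  move=> _; rewrite lexx -subr_ge0 pS divr_ge0 ?(ltW p0) //; split => //.
  by rewrite mulrC -ltr_pdivlMr.
have := ltW (h n p p p_0 p_n tags); rewrite cnorm_distC.
congr (cnorm (_ - _) <= _).
under eq_bigr => k _ do rewrite pS fg.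
rewrite -scaler_sumr -scaler_suml scalerA sg ?ltnS ?leq_maxl //; congr (_ *: _).
rewrite mulrA; congr (_ * _).
by rewrite -(rmorph_nat (real_complex R)) -rmorphM /= divfK.
Qed.

Variable E0 : A -> A.
Hypothesis E0P : is_gauge_expectation lambda E0.

Lemma E0_homogeneous x (g : R -> R[i]) (c : R[i]) N :
  (forall t, lambda (expi t *: 1) x = g t *: x) ->
  (forall n, (N < n)%N ->
    \sum_(k < n) g (2 * pi * k%:R / n%:R) = n%:R * c) ->
  E0 x = c *: x.
Proof.
move=> fg sg; have [I Ix ->] := E0P x.
rewrite (riemann_homogeneous Ix fg sg) scalerA mulrA -rmorphM /= mulVf ?rmorph1 ?mul1r //.
by rewrite gt_eqF // mulr_gt0 ?pi_gt0.
Qed.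

(** The gauge action multiplies a monomial by the character of degree the
    difference of the two lengths. *)
Lemma E0_monomial mu nu :
  E0 (monomial S mu nu) = (size mu == size nu)%:R *: monomial S mu nu.
Proof.
have cX t n : expi t ^+ n * (expi t ^+ n)^*%C = 1.
  by rewrite rmorphXn -exprMn expi_conj expr1n.
have [e|] := eqVneq.
  apply: (E0_homogeneous (N := 0) (fun t => gauge_monomial t mu nu)) => n _.
  under eq_bigr => k _ do rewrite e cX.
  by rewrite sumr_const card_ord mulr1.
case: ltngtP => // mn _.
  have [m m0 e] : exists2 m, (0 < m)%N & size nu = (m + size mu)%N.
    by exists (size nu - size mu)%N; rewrite ?subn_gt0 // subnK // ltnW.
  apply: (E0_homogeneous (N := 2 * m) (fun t => gauge_monomial t mu nu)) => n mln.
  transitivity ((\sum_(k < n) expi (2 * pi * k%:R / n%:R) ^+ m)^*%C : R[i]).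
    rewrite rmorph_sum; apply: eq_bigr => k _.
    by rewrite e exprD rmorphM mulrCA cX mulr1.
  by rewrite sum_expi_pow // rmorph0 mulr0.
have [m m0 e] : exists2 m, (0 < m)%N & size mu = (m + size nu)%N.
  by exists (size mu - size nu)%N; rewrite ?subn_gt0 // subnK // ltnW.
apply: (E0_homogeneous (N := 2 * m) (fun t => gauge_monomial t mu nu)) => n mln.
rewrite mulr0; transitivity (\sum_(k < n) expi (2 * pi * k%:R / n%:R) ^+ m : R[i]).
  by apply: eq_bigr => k _; rewrite e exprD -mulrA cX mulr1.
by rewrite sum_expi_pow.
Qed.

Variable tau : A -> R[i].
Hypothesis tauP : is_normalized_trace S tau.

Lemma tau_lin n a x y : span (core_monomials S n) x -> span (core_monomials S n) y ->
  tau (a *: x + y) = a * tau x + tau y.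
Proof. by case: tauP => h _ _ _ sx sy; apply: h; apply: Fd_core; eassumption. Qed.

Lemma tau0 : tau 0 = 0.
Proof.
have := @tau_lin 0 1 0 0 (span_0 _) (span_0 _).
by rewrite scale1r addr0 mul1r -{1}[tau 0]addr0 => /addrI.
Qed.

Lemma tau_sum n (I : Type) (r : seq I) (F : I -> A) :
  (forall i, span (core_monomials S n) (F i)) ->
  tau (\sum_(i <- r) F i) = \sum_(i <- r) tau (F i).
Proof.
move=> sF; elim: r => [|i r IH]; first by rewrite !big_nil tau0.
rewrite !big_cons -IH -[F i]scale1r (@tau_lin n) ?scale1r ?mul1r //.
exact: span_sum.
Qed.

Lemma span_monomial mu nu : size mu = size nu ->
  span (core_monomials S (size mu)) (monomial S mu nu).
Proof. by move=> e; apply: span_mem; exists mu, nu. Qed.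

(** The range projections of words of equal length are equivalent, through the
    partial isometries [S_mu S_nu^*]. *)
Lemma tau_monomial_diag n : exists t, forall mu, size mu = n -> tau (monomial S mu mu) = t.
Proof.
exists (tau (monomial S (nseq n (Ordinal d_gt0)) (nseq n (Ordinal d_gt0)))) => mu hmu.
set nu := nseq _ _; have hnu : size nu = n by rewrite size_nseq.
have [_ _ _ tr] := tauP.
have := tr (monomial S mu nu) (monomial S nu mu).
rewrite !(monomial_orth A_cuntz) ?hmu ?hnu // !eqxx !scale1r; apply.
  by apply: Fd_core; apply: span_monomial; rewrite hmu.
by apply: Fd_core; apply: span_monomial; rewrite hmu.
Qed.

Lemma tau_monomial_same mu : tau (monomial S mu mu) = d%:R^-1 ^+ size mu.
Proof.
have d0 : d%:R != 0 :> R[i] by rewrite pnatr_eq0 -lt0n.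
move: {-2}(size mu) (erefl (size mu)) => n.
elim: n mu => [|n IH] mu hmu.
  have -> : mu = [::] by apply: size0nil.
  by rewrite /monomial word_nil star1 mulr1 expr0; case: tauP.
case/lastP: mu hmu => // mu i; rewrite size_rcons => -[hmu].
have [t ht] := tau_monomial_diag n.+1.
rewrite ht ?size_rcons ?hmu //.
have := IH mu hmu; rewrite (monomial_expand A_cuntz) (@tau_sum n.+1); last first.
  by move=> j; apply: span_mem; exists (rcons mu j), (rcons mu j); rewrite size_rcons hmu.
under eq_bigr => j _ do rewrite ht ?size_rcons ?hmu //.
rewrite sumr_const card_ord hmu exprS => <-.
by rewrite -[t *+ d]mulr_natl mulKf.
Qed.

Lemma tau_monomial mu nu : size mu = size nu ->
  tau (monomial S mu nu) = (mu == nu)%:R * d%:R^-1 ^+ size mu.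
Proof.
move=> e; have [<-|ne] := eqVneq; first by rewrite mul1r tau_monomial_same.
rewrite mul0r.
have [_ _ _ tr] := tauP.
have := tr (monomial S mu mu) (monomial S mu nu).
rewrite !(monomial_orth A_cuntz) // eqxx scale1r eq_sym (negPf ne) scale0r tau0; apply.
  by apply: Fd_core; apply: span_monomial.
by apply: Fd_core; apply: span_monomial.
Qed.

Lemma omega_monomial mu nu :
  tau (E0 (monomial S mu nu)) = (mu == nu)%:R * d%:R^-1 ^+ size mu.
Proof.
rewrite E0_monomial; have [e|ne] := eqVneq (size mu) (size nu).
  by rewrite scale1r tau_monomial.
rewrite scale0r tau0; have [e|_] := eqVneq mu nu; last by rewrite mul0r.
by rewrite e eqxx in ne.
Qed.

End State.

(** * The KMS property and the commutant of the GNS representation *)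

Section GNS.
Variables (R : realType) (d : nat) (A : cstarAlgType R) (S : 'I_d -> A).
Hypothesis A_cuntz : is_cuntz_algebra S.
Hypothesis d_gt0 : (0 < d)%N.
Variables (H : completeNormedModType R[i]) (dot : {dot H for Num.conj}).
Hypothesis dotP : is_hilbert_dot dot.
Variables (rho : A -> H -> H) (Omega : H).
Hypothesis rhoP : is_representation dot rho.
Hypothesis cyclic : closure (range (fun x => rho x Omega)) = setT.
Hypothesis state_monomial : forall mu nu, dot (rho (monomial S mu nu) Omega) Omega =
  (mu == nu)%:R * d%:R^-1 ^+ size mu.
Implicit Types (x y z b u : A) (mu nu : seq 'I_d) (a : R[i]) (v w : H).

Definition omega x : R[i] := dot (rho x Omega) Omega.

Lemma omega_lin a x y : omega (a *: x + y) = a * omega x + omega y.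
Proof. by rewrite /omega (rep_linear rhoP) dotDl dotZl. Qed.

Lemma omegaD x y : omega (x + y) = omega x + omega y.
Proof. by rewrite -[x]scale1r omega_lin mul1r scale1r. Qed.

Lemma omegaZ a x : omega (a *: x) = a * omega x.
Proof. by rewrite /omega (repZ rhoP) dotZl. Qed.

Lemma omega0 : omega 0 = 0.
Proof. by rewrite -(scale0r (0 : A)) omegaZ mul0r. Qed.

Lemma omegaB x y : omega (x - y) = omega x - omega y.
Proof. by rewrite omegaD -scaleN1r omegaZ mulN1r. Qed.

Lemma omega_star x : omega (star x) = (omega x)^*%C.
Proof. by rewrite /omega -dotC (rep_star rhoP) starK. Qed.

Lemma hn_rep y : hn (rho y Omega) ^+ 2 = complex.Re (omega (star y * y)).
Proof. by rewrite -(rdot_hn dotP) /rdot /omega (repM rhoP) (rep_star rhoP (star y)) starK. Qed.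

Lemma omega_cont : exists2 c : R, 0 <= c & forall x, `|omega x| <= (c * cnorm x)%:C%C.
Proof.
exists (hn Omega * hn Omega) => [|x]; first by rewrite mulr_ge0 ?hn_ge0.
apply: le_trans (normr_dot_le dotP _ _) _; rewrite lecR.
rewrite mulrAC ler_wpM2r ?hn_ge0 // mulrC.
exact: (rep_contractive dotP rhoP).
Qed.

(** The state is continuous because representations are contractive, so that
    density of the monomials applies. *)
Lemma omega_ext (f g : A -> A) c a : linear f -> linear g ->
  (forall x, cnorm (f x) <= c * cnorm x) -> (forall x, cnorm (g x) <= c * cnorm x) ->
  (forall mu nu, omega (f (monomial S mu nu)) = a * omega (g (monomial S mu nu))) ->
  forall x, omega (f x) = a * omega (g x).
Proof.
move=> lf lg bf bg h x.
have hs y : span (monomials S) y -> omega (f y) = a * omega (g y).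
  elim=> [|b u w [mu [nu ->]] _ IH]; first by rewrite (lin_0 lf) (lin_0 lg) omega0 mulr0.
  by rewrite lf lg !omega_lin IH h mulrDr mulrCA.
have [C C0 omC] := omega_cont.
pose k := complex.Re `|a|.
have ak : `|a| = k%:C%C by rewrite RRe_real ?normr_real.
have k0 : 0 <= k by rewrite -ler0c -ak.
apply/eqP; rewrite -subr_eq0 -normr_eq0.
set z := _ - _; have zR : `|z| = (complex.Re `|z|)%:C%C by rewrite RRe_real ?normr_real.
suff : complex.Re `|z| <= 0 by rewrite -lecR -zR => h0; rewrite eq_le h0 normr_ge0.
apply/ler_addgt0Pr => e e0; rewrite add0r.
have c0 : 0 <= `|c| by [].
have [|y sy xy] := span_monomials_dense A_cuntz x (e := e / (C * `|c| * (1 + k) + 1)).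
  by rewrite divr_gt0 // ltr_wpDl // !mulr_ge0 // addr_ge0.
have -> : z = omega (f (x - y)) - a * omega (g (x - y)).
  rewrite (lin_sub lf) (lin_sub lg) !omegaB (hs _ sy) mulrBr /z.
  by rewrite opprB addrA subrK.
pose B := C * `|c| * cnorm (x - y).
have bnd (q : A -> A) : (forall x, cnorm (q x) <= c * cnorm x) ->
    `|omega (q (x - y))| <= B%:C%C.
  move=> bq; apply: le_trans (omC _) _; rewrite lecR /B -mulrA ler_wpM2l //.
  apply: le_trans (bq _) _; rewrite ler_wpM2r ?cnorm_ge0 //; exact: ler_norm.
have : `|omega (f (x - y)) - a * omega (g (x - y))| <= (B + k * B)%:C%C.
  apply: le_trans (ler_normB _ _) _; rewrite normrM ak rmorphD (rmorphM _ k B).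
  by apply: lerD; [exact: (bnd f bf)|apply: ler_wpM2l; [rewrite ler0c|exact: (bnd g bg)]].
rewrite /B.
rewrite -[X in X <= _](@RRe_real R) ?normr_real // lecR => /le_trans; apply.
move: xy; rewrite ltr_pdivlMr; last by rewrite ltr_wpDl // !mulr_ge0 // addr_ge0.
have := cnorm_ge0 (x - y); move: (cnorm _) => t t0.
by nra.
Qed.

(** The KMS property of the state for the gauge action, read off from the values
    on monomials. *)
Lemma omega_gen i z : omega (z * S i) = d%:R * omega (S i * z).
Proof.
apply: (@omega_ext (fun z => z * S i) (fun z => S i * z) (cnorm (S i))).
- exact: mulr_lin.
- exact: mull_lin.
- by move=> x; rewrite mulrC cnormM.
- by move=> x; rewrite cnormM.
move=> mu nu; have -> : S i * monomial S mu nu = monomial S (i :: mu) nu.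
  by rewrite /monomial word_cons mulrA.
rewrite [X in _ = _ * X]state_monomial; case: nu => [|j nu].
  have -> : monomial S mu [::] * S i = monomial S (rcons mu i) [::].
    by rewrite /monomial word_nil star1 !mulr1 word_rcons.
  by rewrite /omega state_monomial -size_eq0 size_rcons !mul0r mulr0.
have -> : monomial S mu (j :: nu) * S i = (j == i)%:R *: monomial S mu nu.
  rewrite /monomial word_cons starM -!mulrA (cuntz_orth A_cuntz).
  by have [_|_] := eqVneq j i; rewrite ?scale1r ?scale0r ?mulr1 ?mulr0.
rewrite omegaZ /omega state_monomial eqseq_cons (eq_sym i).
have [_|_] := eqVneq j i; last by rewrite !mul0r mulr0.
rewrite mul1r /= exprS mulrCA; congr (_ * _).
by rewrite mulVKf // pnatr_eq0 -lt0n.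
Qed.

Lemma omega_word mu z : omega (z * word S mu) = d%:R ^+ size mu * omega (word S mu * z).
Proof.
elim: mu z => [|i mu IH] z; first by rewrite word_nil mulr1 mul1r expr0 mul1r.
by rewrite word_cons mulrA IH mulrA omega_gen exprSr -!mulrA.
Qed.

Lemma omega_word_star mu z :
  omega (star (word S mu) * z) = d%:R ^+ size mu * omega (z * star (word S mu)).
Proof.
rewrite -[z]starK -!starM !omega_star omega_word rmorphM /= rmorphXn /= conjc_nat.
by [].
Qed.

(** Moving [S_mu] and [S_nu^*] around the product gives inverse powers of [d] when
    the two words have the same length. *)
Lemma omega_core_comm n u z : span (core_monomials S n) u -> omega (z * u) = omega (u * z).
Proof.
elim=> [|a x y [mu [nu [hm hn ->]]] _ IH]; first by rewrite mulr0 mul0r.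
rewrite mulrDr mulrDl -scalerAr -scalerAl !omega_lin IH; congr (_ * _ + _).
have d0 : d%:R ^+ n != 0 :> R[i] by rewrite expf_neq0 // pnatr_eq0 -lt0n.
apply: (mulfI d0).
rewrite /monomial mulrA -{1}hn -omega_word_star mulrA omega_word hm.
by rewrite -mulrA.
Qed.

Lemma cyclic_dense v : hcl (range (fun x => rho x Omega)) v.
Proof. by apply/closure_hcl; rewrite cyclic. Qed.

Lemma cyclic_words v : hcl [set rho x Omega | x in span (monomials S)] v.
Proof.
move=> e e0; have e2 : 0 < e / 2 by rewrite divr_gt0.
have [_ [x _ <-] vx] := cyclic_dense v e2.
have [|y sy xy] := span_monomials_dense A_cuntz x (e := e / 2 / (hn Omega + 1)).
  by rewrite divr_gt0 // ltr_wpDl // hn_ge0.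
exists (rho y Omega); first by exists y.
apply: le_lt_trans (hn_triangle (rho x Omega) _ _) _.
rewrite [e in _ < e]splitr ltr_leD // -(repB rhoP).
apply: le_trans (rep_contractive dotP rhoP _ _) _.
move: xy; rewrite ltr_pdivlMr ?ltr_wpDl ?hn_ge0 //.
have := cnorm_ge0 (x - y); have := hn_ge0 Omega.
by move: (hn _) (cnorm _) => s t; nra.
Qed.

Definition right_bounded b c := forall y,
  hn (rho (y * b) Omega) <= c * hn (rho y Omega).

Lemma right_bounded_sqr b c : 0 <= c ->
  (forall y, complex.Re (omega (star (y * b) * (y * b))) <=
     c ^+ 2 * complex.Re (omega (star y * y))) -> right_bounded b c.
Proof.
move=> c0 h y; rewrite -(@ler_pXn2r _ 2) ?nnegrE ?mulr_ge0 ?hn_ge0 //.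
by rewrite exprMn !hn_rep.
Qed.

(** Left and right multiplications commute on the dense orbit of [Omega]. *)
Lemma right_multiplication b c : 0 <= c -> right_bounded b c ->
  exists T, [/\ commutant (range rho) T,
    forall y, T (rho y Omega) = rho (y * b) Omega &
    forall v, hn (T v) <= c * hn v].
Proof.
move=> c0 bc.
have lp : linear (fun y => rho y Omega).
  by move=> a x y; rewrite (rep_linear rhoP).
have lq : linear (fun y => rho (y * b) Omega).
  by move=> a x y; rewrite mulr_lin (rep_linear rhoP).
have [T [bT TE Tc]] := bounded_extension lp lq cyclic_dense c0 bc.
exists T; split=> //; split=> // _ [x _ <-].
apply: (bounded_eq_dense _ _ cyclic_dense).
- by apply: bounded_comp => //; apply: (rep_bounded rhoP).
- by apply: bounded_comp => //; apply: (rep_bounded rhoP).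
by move=> _ [y _ <-] /=; rewrite -(repM rhoP) !TE -mulrA (repM rhoP).
Qed.

Lemma right_bounded_unitary n u : span (core_monomials S n) u -> u * star u = 1 ->
  right_bounded u 1.
Proof.
move=> su uu; apply: right_bounded_sqr => // y.
rewrite expr1n mul1r starM mulrA (omega_core_comm _ su) !mulrA uu mul1r.
by [].
Qed.

(** By the KMS property [|y S_i Omega|^2] sums over [i] to [d |y Omega|^2], and
    [d |y S_i^* Omega|^2 = |y Omega|^2]. *)
Lemma right_bounded_words b : span (monomials S) b -> exists2 c, 0 <= c & right_bounded b c.
Proof.
have d0 : d%:R != 0 :> R[i] by rewrite pnatr_eq0 -lt0n.
have d1 : 1 <= d%:R :> R by rewrite ler1n.
have rbM x y : (exists2 c, 0 <= c & right_bounded x c) ->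
    (exists2 c, 0 <= c & right_bounded y c) ->
    exists2 c, 0 <= c & right_bounded (x * y) c.
  move=> [c c0 hc] [c' c'0 hc']; exists (c' * c) => [|z]; first exact: mulr_ge0.
  rewrite mulrA; apply: le_trans (hc' _) _.
  by rewrite -mulrA ler_wpM2l.
have Reom z (t : R) : complex.Re (t%:C%C * omega z) = t * complex.Re (omega z).
  by case: (omega z) => p q /=; rewrite mul0r subr0.
have rb1 : exists2 c, 0 <= c & right_bounded 1 c.
  by exists 1 => // y; rewrite mulr1 mul1r.
have rbS i : exists2 c, 0 <= c & right_bounded (S i) c.
  exists d%:R => //; apply: right_bounded_sqr => // y.
  have e j : omega (star (y * S j) * (y * S j)) =
      d%:R * omega (S j * (star (S j)) * (star y * y)).
    by rewrite starM mulrA omega_gen !mulrA.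
  have s : \sum_j complex.Re (omega (star (y * S j) * (y * S j))) =
      d%:R * complex.Re (omega (star y * y)).
    rewrite -Reom -[in RHS](mul1r (star y * y)) -(cuntz_sum A_cuntz) mulr_suml.
    rewrite (big_morph omega omegaD omega0) mulr_sumr raddf_sum; apply: eq_bigr => j _ /=.
    by rewrite e rmorph_nat.
  apply: (@le_trans _ _ (d%:R * complex.Re (omega (star y * y)))).
    rewrite -s (bigD1 i) //= lerDl sumr_ge0 // => j _.
    by rewrite -hn_rep exprn_ge0 // hn_ge0.
  by rewrite -hn_rep ler_wpM2r ?exprn_ge0 ?hn_ge0 // ler_eXnr.
have rbSs i : exists2 c, 0 <= c & right_bounded (star (S i)) c.
  exists 1 => //; apply: right_bounded_sqr => // y.
  rewrite expr1n mul1r starM starK.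
  have e : d%:R * omega (S i * star y * (y * star (S i))) = omega (star y * y).
    rewrite -mulrA -omega_gen -!mulrA (cuntz_orth A_cuntz) eqxx mulr1.
    by [].
  have := congr1 (@complex.Re R) e; rewrite -[d%:R](rmorph_nat (real_complex R)) Reom => <-.
  rewrite ler_peMl //.
  have := hn_rep (y * star (S i)); rewrite starM starK => <-.
  by rewrite exprn_ge0 ?hn_ge0.
have rbw mu : exists2 c, 0 <= c & right_bounded (word S mu) c.
  by elim: mu => [|i mu IH]; rewrite ?word_nil // word_cons; apply: rbM.
have rbws mu : exists2 c, 0 <= c & right_bounded (star (word S mu)) c.
  by elim: mu => [|i mu IH]; rewrite ?word_nil ?star1 // word_cons starM; apply: rbM.
elim=> [|a x y [mu [nu ->]] _ [c c0 hc]].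
  by exists 0 => // y; rewrite mulr0 (rep0 rhoP) hn0 mul0r.
have [c' c'0 hc'] := rbM _ _ (rbw mu) (rbws nu).
have a0 : 0 <= complex.Re `|a| by rewrite -ler0c RRe_real ?normr_real.
exists (complex.Re `|a| * c' + c) => [|z]; first by rewrite addr_ge0 ?mulr_ge0.
rewrite mulrDr -scalerAr (rep_linear rhoP).
apply: le_trans (hnD _ _) _; rewrite hnZ mulrDl lerD // -mulrA.
by rewrite ler_wpM2l.
Qed.

(** The vector [Omega] is cyclic for the commutant, which contains the right
    multiplications by words. *)
Lemma separating (m : H -> H) : bicommutant (range rho) m -> m Omega = 0 ->
  m = fun=> 0.
Proof.
move=> [bm cm] m0; apply: (bounded_eq_dense bm (bounded_0 H) cyclic_words).
move=> _ [b sb <-]; have [c c0 bc] := right_bounded_words sb.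
have [T [cT TE _]] := right_multiplication c0 bc.
have : m (T (rho 1 Omega)) = T (m (rho 1 Omega)).
  by have /funeqP/(_ (rho 1 Omega)) := cm _ cT.
rewrite TE mul1r (rep1 rhoP) m0 => ->.
by rewrite (lin_0 (bounded_lin (proj1 cT))).
Qed.

End GNS.

(** * R-matrices in the Cuntz algebra *)

Section MatrixUnits.
Variables (R : realType) (A : cstarAlgType R).
Implicit Types (x y : A).

(** A family of isometries with pairwise orthogonal ranges summing to [1] gives
    matrix units [e p * star (e q)], hence a copy of a matrix algebra. The words
    of length two and of length three are the families needed to read the
    matrix identities of an R-matrix in the Cuntz algebra. *)
Record cuntz_family m (e : 'I_m -> A) : Prop := CuntzFamily {
  family_orth : forall p q, star (e p) * e q = (p == q)%:R;
  family_sum : \sum_p e p * star (e p) = 1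
}.

Definition emb m (e : 'I_m -> A) (r : 'M[R[i]]_m) : A :=
  \sum_p \sum_q r p q *: (e p * star (e q)).

Lemma family_ext m (e : 'I_m -> A) x y : cuntz_family e ->
  (forall q, x * e q = y * e q) -> x = y.
Proof.
move=> he h; rewrite -[x]mulr1 -[y]mulr1 -(family_sum he) !mulr_sumr.
by apply: eq_bigr => q _; rewrite !mulrA h.
Qed.

Lemma emb_col m (e : 'I_m -> A) r q : cuntz_family e ->
  emb e r * e q = \sum_p r p q *: e p.
Proof.
move=> he; rewrite /emb mulr_suml; apply: eq_bigr => p _.
rewrite mulr_suml (bigD1 q) //= -scalerAl -mulrA (family_orth he) eqxx mulr1.
rewrite big1 ?addr0 // => s /negPf sq.
by rewrite -scalerAl -mulrA (family_orth he) sq mulr0 scaler0.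
Qed.

Lemma embM m (e : 'I_m -> A) r s : cuntz_family e ->
  emb e (r *m s) = emb e r * emb e s.
Proof.
move=> he; apply: (family_ext he) => q; rewrite -mulrA !emb_col // mulr_sumr.
under [RHS]eq_bigr => p _ do rewrite -scalerAr emb_col // scaler_sumr.
rewrite exchange_big; apply: eq_bigr => p _ /=.
rewrite mxE scaler_suml; apply: eq_bigr => k _.
by rewrite scalerA mulrC.
Qed.

Lemma emb1 m (e : 'I_m -> A) : cuntz_family e -> emb e 1%:M = 1.
Proof.
move=> he; apply: (family_ext he) => q; rewrite emb_col // mul1r (bigD1 q) //=.
rewrite mxE eqxx scale1r big1 ?addr0 // => p /negPf pq.
by rewrite mxE pq scale0r.
Qed.

Lemma emb_star m (e : 'I_m -> A) (r : 'M[R[i]]_m) :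
  star (emb e r) = emb e (map_mx Num.conj r^T).
Proof.
rewrite /emb star_sum exchange_big /=; apply: eq_bigr => p _.
rewrite star_sum; apply: eq_bigr => q _.
by rewrite starZ starM starK !mxE.
Qed.

Lemma big_mxtens m n (F : 'I_(m * n) -> A) :
  \sum_P F P = \sum_p \sum_q F (mxtens_index (p, q)).
Proof.
rewrite pair_bigA /= (reindex (@mxtens_index m n)) /=; last first.
  by exists (@mxtens_unindex m n) => ? _; rewrite ?mxtens_indexK ?mxtens_unindexK.
by apply: eq_bigr => -[p q].
Qed.

Definition tens_family m n (e : 'I_m -> A) (f : 'I_n -> A) (P : 'I_(m * n)) : A :=
  e (mxtens_unindex P).1 * f (mxtens_unindex P).2.

Lemma tens_familyE m n (e : 'I_m -> A) (f : 'I_n -> A) p q :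
  tens_family e f (mxtens_index (p, q)) = e p * f q.
Proof. by rewrite /tens_family mxtens_indexK. Qed.

Lemma cuntz_tens m n (e : 'I_m -> A) (f : 'I_n -> A) :
  cuntz_family e -> cuntz_family f -> cuntz_family (tens_family e f).
Proof.
move=> he hf; split.
  move=> P Q; case: (mxtens_indexP P) => p q; case: (mxtens_indexP Q) => p' q'.
  rewrite !tens_familyE starM mulrA -(mulrA (star (f q))) (family_orth he).
  rewrite (can_eq (@mxtens_indexK m n)) xpair_eqE.
  by have [_|_] := eqVneq p p'; rewrite ?mulr0 ?mul0r // mulr1 (family_orth hf).
rewrite big_mxtens -(family_sum he); apply: eq_bigr => p _.
under eq_bigr => q _ do rewrite tens_familyE starM mulrA -(mulrA (e p)).
by rewrite -mulr_suml -mulr_sumr (family_sum hf) mulr1.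
Qed.

End MatrixUnits.

Section RMatrix.
Variables (R : realType) (d : nat) (A : cstarAlgType R) (S : 'I_d -> A).
Hypothesis A_cuntz : is_cuntz_algebra S.
Implicit Types (x y z : A) (mu nu : seq 'I_d).
Local Notation phi := (canonical_endo S).

Lemma cuntz_gens : cuntz_family S.
Proof. by split; [exact: (cuntz_orth A_cuntz)|exact: (cuntz_sum A_cuntz)]. Qed.

Let S2 := tens_family S S.
Let S3 := tens_family S2 S.

Lemma mx2_embedE (r : 'M[R[i]]_(d * d)) : mx2_embed S r = emb S2 r.
Proof.
rewrite /mx2_embed /emb big_mxtens; apply: eq_bigr => i _; apply: eq_bigr => j _.
rewrite big_mxtens; apply: eq_bigr => k _; apply: eq_bigr => l _.
by rewrite /S2 !tens_familyE.
Qed.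

Lemma mx2_embed_core r : span (core_monomials S 2) (mx2_embed S r).
Proof.
rewrite /mx2_embed; apply: span_sum => i; apply: span_sum => j; apply: span_sum => k.
apply: span_sum => l; apply: spanZ; apply: span_mem; exists [:: i; j], [:: k; l].
by rewrite /monomial !word_cons !word_nil !mulr1.
Qed.

Variable r : 'M[R[i]]_(d * d).
Hypothesis rP : is_rmatrix r.
Local Notation Ru := (mx2_embed S r).

Lemma rmatrix_unitary : unitary Ru.
Proof.
have S2c : cuntz_family S2 := cuntz_tens cuntz_gens cuntz_gens.
have [/unitarymxP u _] := rP.
rewrite mx2_embedE /unitary emb_star -!embM //.
by rewrite u (mulmx1C u) !emb1.
Qed.

(** In the matrix algebra of the words of length three, [R] tensored with the
    identity on the right is [R] itself, and on the left it is [phi R]. *)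
Lemma rmatrix_braid : Ru * phi Ru * Ru = phi Ru * Ru * phi Ru.
Proof.
have S2c : cuntz_family S2 := cuntz_tens cuntz_gens cuntz_gens.
have S3c : cuntz_family S3 := cuntz_tens S2c cuntz_gens.
have [_ /(congr1 (emb S3))] := rP; rewrite !embM //.
set r12 := r *t _; set r23 := castmx _ _.
suff [-> ->] : emb S3 r12 = Ru /\ emb S3 r23 = phi Ru by [].
split; apply: (family_ext S3c) => Q; rewrite emb_col //;
  case: (mxtens_indexP Q) => pq k; rewrite /S3 tens_familyE.
  rewrite mulrA mx2_embedE emb_col // mulr_suml big_mxtens.
  apply: eq_bigr => p _; rewrite (bigD1 k) //= big1 ?addr0.
    by rewrite tens_familyE tensmxE mxE eqxx mulr1 scalerAl.
  by move=> q /negPf qk; rewrite tensmxE mxE qk mulr0 scale0r.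
case: (mxtens_indexP pq) => i j.
rewrite /S2 tens_familyE !mulrA (phi_gen A_cuntz) -!mulrA.
rewrite -(tens_familyE S S j k) mx2_embedE emb_col //.
have castE (a b c : 'I_d) : cast_ord (esym (mulnA d d d))
    (mxtens_index (mxtens_index (a, b), c)) =
    mxtens_index (a, mxtens_index (b, c)).
  by apply: val_inj; rewrite /= mulnDl mulnA addnA.
rewrite big_mxtens big_mxtens (bigD1 i) //= [X in _ + X]big1 ?addr0.
  rewrite mulr_sumr big_mxtens; apply: eq_bigr => b _; apply: eq_bigr => c _.
  rewrite !tens_familyE castmxE !castE tensmxE mxE eqxx mul1r -scalerAr.
  by rewrite /S2 tens_familyE mulrA.
move=> a /negPf ai; apply: big1 => b _; apply: big1 => c _.
by rewrite castmxE !castE tensmxE mxE ai mul0r scale0r.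
Qed.

Variable lambda : A -> A -> A.
Hypothesis lambdaP : is_lambda S lambda.
Local Notation g := (lambda Ru).

Let g_lin : linear g.
Proof. by have [[]] := lambdaP rmatrix_unitary. Qed.
Let gM x y : g (x * y) = g x * g y.
Proof. by have [[_ h _ _] _] := lambdaP rmatrix_unitary; apply: h. Qed.
Let g1 : g 1 = 1.
Proof. by have [[]] := lambdaP rmatrix_unitary. Qed.
Let g_star x : g (star x) = star (g x).
Proof. by have [[_ _ _ h] _] := lambdaP rmatrix_unitary; apply: h. Qed.
Let g_gen i : g (S i) = Ru * S i.
Proof. by have [_ h] := lambdaP rmatrix_unitary; apply: h. Qed.
Let RsR : star Ru * Ru = 1.
Proof. by case: rmatrix_unitary. Qed.
Let RRs : Ru * star Ru = 1.
Proof. by case: rmatrix_unitary. Qed.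

(** The unitaries [R phi(R) ... phi^(n-1)(R)]; conjugation by them is the
    endomorphism on the [n]-th matrix algebra of the core. *)
Fixpoint cocycle n : A := if n is n'.+1 then Ru * phi (cocycle n') else 1.

Lemma cocycle_core n : span (core_monomials S n.+1) (cocycle n).
Proof.
elim: n => [|n IH] /=; first exact: (span_core1 A_cuntz).
apply: (span_coreM A_cuntz); last exact: phi_core.
exact: (span_core_le A_cuntz) (mx2_embed_core r).
Qed.

Lemma cocycle_unitary n : star (cocycle n) * cocycle n = 1 /\
  cocycle n * star (cocycle n) = 1.
Proof.
elim: n => [|n [IH1 IH2]] /=; first by rewrite star1 mulr1.
rewrite starM -phi_star; split.
  by rewrite mulrA -(mulrA _ (star Ru)) RsR mulr1 -(phiM A_cuntz) IH1 (phi1 A_cuntz).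
by rewrite mulrA -(mulrA Ru) -(phiM A_cuntz) IH2 (phi1 A_cuntz) mulr1 RRs.
Qed.

Lemma endo_word mu : g (word S mu) = cocycle (size mu) * word S mu.
Proof.
elim: mu => [|i mu IH]; first by rewrite word_nil g1 mul1r.
by rewrite word_cons gM IH g_gen /= -!mulrA; congr (_ * _); rewrite !mulrA (phi_gen A_cuntz).
Qed.

Lemma endo_core n x : span (core_monomials S n) x -> g x = cocycle n * x * star (cocycle n).
Proof.
elim=> [|a y z [mu [nu [hm hn ->]]] _ IH]; first by rewrite (lin_0 g_lin) mulr0 mul0r.
rewrite g_lin mullr_lin IH; congr (_ *: _ + _).
by rewrite gM g_star !endo_word hm hn starM !mulrA.
Qed.

Lemma endo_phi x : g (phi x) = Ru * phi (g x) * star Ru.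
Proof.
rewrite /canonical_endo (lin_sum g_lin) mulr_sumr mulr_suml; apply: eq_bigr => i _.
by rewrite !gM g_star g_gen starM !mulrA.
Qed.

Lemma phi2_comm x y : span (core_monomials S 2) x -> phi (phi y) * x = x * phi (phi y).
Proof.
elim=> [|a u v [mu [nu [hm hn ->]]] _ IH]; first by rewrite mulr0 mul0r.
rewrite mulrDr mulrDl IH -scalerAl -scalerAr; congr (_ *: _ + _).
case: mu hm => [|i [|j []]] //= _; case: nu hn => [|k [|l []]] //= _.
rewrite /monomial !word_cons !word_nil !mulr1 starM.
rewrite !mulrA (phi_gen A_cuntz (phi y)) -(mulrA (S i) (phi y)) (phi_gen A_cuntz y).
by rewrite -!mulrA (gen_phi A_cuntz (phi y)) (mulrA (star (S l))) (gen_phi A_cuntz y) !mulrA.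
Qed.

Lemma endo_R : g Ru = phi Ru.
Proof.
rewrite (endo_core (mx2_embed_core r)) /= (phiM A_cuntz) !(phi1 A_cuntz) !mulr1.
rewrite starM mulrA rmatrix_braid -!mulrA.
rewrite (mulrA (phi Ru) (star _)) -phi_star -(phiM A_cuntz) RRs (phi1 A_cuntz) mul1r.
by rewrite RRs mulr1.
Qed.

(** For [k = 0] this is the braid relation. The twist by [R] in [endo_phi] then
    disappears since [R] commutes with the range of [phi^2]. *)
Lemma endo_phi_iter k : g (iter k phi Ru) = iter k.+1 phi Ru.
Proof.
elim: k => [|k IH]; first exact: endo_R.
rewrite iterS endo_phi IH !iterS -(phi2_comm _ (mx2_embed_core r)).
by rewrite -mulrA RRs mulr1.
Qed.

Lemma unitary_comm_star (u x : A) : star u * u = 1 -> u * star u = 1 ->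
  u * x = x * u -> u * star x = star x * u.
Proof.
move=> uu1 uu2 /(congr1 (@star _ A)); rewrite !starM => h.
rewrite -[star x]mulr1 -{1}uu1 !mulrA -(mulrA u) h.
by rewrite mulrA uu2 mul1r mulr1.
Qed.

(** The squared endomorphism maps [S_i] to [phi(R) R S_i], and
    [R phi(R) R S_i = phi(R) R phi(R) S_i = phi(R) R S_i R]. *)
Lemma endo2_comm x : span (monomials S) x -> Ru * g (g x) = g (g x) * Ru.
Proof.
have gg_gen i : Ru * g (g (S i)) = g (g (S i)) * Ru.
  rewrite g_gen gM endo_R g_gen !mulrA rmatrix_braid -!mulrA.
  by rewrite (phi_gen A_cuntz).
have gg_word mu : Ru * g (g (word S mu)) = g (g (word S mu)) * Ru.
  elim: mu => [|i mu IH]; first by rewrite word_nil !g1 mulr1 mul1r.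
  by rewrite word_cons !gM mulrA gg_gen -mulrA IH mulrA.
elim=> [|a u v [mu [nu ->]] _ IH]; first by rewrite !(lin_0 g_lin) mulr0 mul0r.
rewrite !g_lin mulrDr mulrDl IH -scalerAl -scalerAr; congr (_ *: _ + _).
rewrite !gM !g_star mulrA gg_word -mulrA (unitary_comm_star RsR RRs (gg_word nu)).
by rewrite mulrA.
Qed.

End RMatrix.

(** * Fixed points and iterated ranges *)

Section Core.
Variables (R : realType) (d : nat) (A : cstarAlgType R) (S : 'I_d -> A).
Hypothesis A_cuntz : is_cuntz_algebra S.
Hypothesis d_gt0 : (0 < d)%N.
Variables (H : completeNormedModType R[i]) (dot : {dot H for Num.conj}).
Hypothesis dotP : is_hilbert_dot dot.
Variables (rho : A -> H -> H) (Omega : H).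
Hypothesis rhoP : is_representation dot rho.
Hypothesis cyclic : closure (range (fun x => rho x Omega)) = setT.
Hypothesis state_monomial : forall mu nu, dot (rho (monomial S mu nu) Omega) Omega =
  (mu == nu)%:R * d%:R^-1 ^+ size mu.
Implicit Types (a b x y : A) (v w : H) (m T : H -> H).

Local Notation M := (bicommutant (range rho)).
Local Notation N := (bicommutant (rho @` Fd S)).

Lemma range_rep_bounded : range rho `<=` @bounded_ops R H.
Proof. by move=> _ [x _ <-]; apply: (rep_bounded rhoP). Qed.

Lemma M_rep x : M (rho x).
Proof. by apply: (sub_bicommutant range_rep_bounded); exists x. Qed.

Lemma N_sub_M : N `<=` M.
Proof. by apply: commutantS; apply: commutantS => _ [x _ <-]; exists x. Qed.

Lemma commutant_linear (X : set (H -> H)) T : commutant X T -> linear T.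
Proof. by move=> [bx _]; apply: bounded_lin. Qed.

Lemma M_sub m m' : M m -> M m' -> M (fun v => m v - m' v).
Proof. by apply: commutant_sub => T; apply: commutant_linear. Qed.

Lemma M_comp m m' : M m -> M m' -> M (m \o m').
Proof. exact: commutant_comp. Qed.

Lemma M_adjoint m : M m -> exists2 m', M m' & adjoint_ops dot m m'.
Proof.
apply: (commutant_has_adjoints dotP) => T cT.
apply: (commutant_has_adjoints dotP) cT => _ [x _ <-].
by exists (rho (star x)); [exists (star x)|apply: (rep_star rhoP)].
Qed.

Lemma hcl_subspace (D : set H) : D 0 ->
  (forall c u v, D u -> D v -> D (c *: u + v)) -> closed_subspace (hcl D).
Proof.
move=> D0 Dlin; split.
- by move=> e e0; exists 0 => //; rewrite subrr hn0.
- move=> c u v cu cv e e0.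
  have k0 : 0 <= complex.Re `|c| by rewrite -ler0c RRe_real ?normr_real.
  have e1 : 0 < e / (complex.Re `|c| + 1) by rewrite divr_gt0 // ltr_wpDl.
  have [u' Du uu] := cu _ e1; have [v' Dv vv] := cv _ e1.
  exists (c *: u' + v'); first exact: Dlin.
  rewrite opprD addrACA -scalerBr; apply: le_lt_trans (hnD _ _) _; rewrite hnZ.
  have -> : e = complex.Re `|c| * (e / (complex.Re `|c| + 1)) + e / (complex.Re `|c| + 1).
    by field; rewrite gt_eqF // ltr_wpDl.
  by apply: ler_ltD => //; rewrite ler_wpM2l // ltW.
move=> v cv e e0; have e2 : 0 < e / 2 by rewrite divr_gt0.
have [w /(_ _ e2)[z Dz wz] vw] := cv _ e2; exists z => //.
by apply: le_lt_trans (hn_triangle w _ _) _; rewrite (splitr e) ltrD.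
Qed.

Definition core_vectors : set H :=
  [set v | exists n a, span (core_monomials S n) a /\ v = rho a Omega].

Lemma core_vectors_lin c u v :
  core_vectors u -> core_vectors v -> core_vectors (c *: u + v).
Proof.
move=> [n [a [sa ->]]] [p [b [sb ->]]]; exists (maxn n p), (c *: a + b).
rewrite (rep_linear rhoP); split=> //; apply: span_lin.
  exact: (span_core_le A_cuntz) (leq_maxl _ _) sa.
exact: (span_core_le A_cuntz) (leq_maxr _ _) sb.
Qed.

Lemma core_vectors_invariant x v :
  Fd S x -> hcl core_vectors v -> hcl core_vectors (rho x v).
Proof.
rewrite (Fd_span S) => cx cv e e0; have e2 : 0 < e / 2 by rewrite divr_gt0.
have x1 : 0 < cnorm x + 1 by rewrite ltr_wpDl // cnorm_ge0.
have [_ [n [b [sb ->]]] vb] := cv _ (divr_gt0 e2 x1).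
have b1 : 0 < hn (rho b Omega) + 1 by rewrite ltr_wpDl // hn_ge0.
have [a [p sa] xa] := cx _ (divr_gt0 e2 b1).
exists (rho (a * b) Omega).
  exists (maxn p n), (a * b); split=> //; apply: (span_coreM A_cuntz).
    exact: (span_core_le A_cuntz) (leq_maxl _ _) sa.
  exact: (span_core_le A_cuntz) (leq_maxr _ _) sb.
apply: le_lt_trans (hn_triangle (rho x (rho b Omega)) _ _) _.
rewrite (repM rhoP) -(repB rhoP) -(lin_sub (rep_lin rhoP x)) (splitr e).
have h1 := rep_contractive dotP rhoP x (v - rho b Omega).
have h2 := rep_contractive dotP rhoP (x - a) (rho b Omega).
move: vb xa; rewrite (ltr_pdivlMr _ _ x1) (ltr_pdivlMr _ _ b1) => h3 h4.
have h5 := hn_ge0 (v - rho b Omega); have h6 := cnorm_ge0 (x - a).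
by apply: ltrD; lra.
Qed.

(** The projection [P] onto the closure of the core vectors commutes with the core
    and fixes [Omega], so that [m Omega = m P Omega = P m Omega]. *)
Lemma N_approx m : N m -> hcl core_vectors (m Omega).
Proof.
move=> [bm cm]; have D0 : core_vectors 0.
  by exists 0%N, 0; rewrite (rep0 rhoP); split=> //; apply: span_0.
have [P [bP PK Pid PP]] := projection_exists dotP (hcl_subspace D0 core_vectors_lin).
have cP : commutant (rho @` Fd S) P.
  split=> // _ [x Fx <-].
  apply: (projection_commutes PK Pid PP (rep_star rhoP x)) => v.
    exact: core_vectors_invariant.
  by apply: core_vectors_invariant; apply: Fd_star.
have PO : P Omega = Omega.
  apply: Pid => e e0; exists Omega; last by rewrite subrr hn0.
  by exists 0%N, 1; rewrite (rep1 rhoP); split=> //; apply: (span_core1 A_cuntz).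
rewrite -PO; have /funeqP/(_ Omega) /= -> := cm _ cP.
exact: PK.
Qed.

(** If [y] commutes with the core then so does [psi y = \sum_k S_k y S_k^*], because
    [S_k^* a S_l] is in the core when [a] is. An operator of [N] thus commutes
    with [psi y], and compressing [psi y] by generators gives back [y]. *)
Lemma N_corner i j m : N m -> N (rho (star (S i)) \o m \o rho (S j)).
Proof.
move=> [bm cm].
have br x := rep_bounded rhoP x; have lr x := rep_lin rhoP x.
split; first by apply: bounded_comp => //; apply: bounded_comp.
move=> y [by_ cy]; have ly := bounded_lin by_.
pose psi v := \sum_k rho (S k) (y (rho (star (S k)) v)).
have cpsi : commutant (rho @` Fd S) psi.
  split.
    apply: bounded_sum => k; apply: (@bounded_comp _ _ (rho (S k))) => //.
    exact: (@bounded_comp _ _ y).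
  move=> _ [a Fa <-]; apply/funext => v; rewrite /psi /=.
  have step k : rho (S k) (y (rho (star (S k)) (rho a v))) =
      \sum_l rho (S k) (rho (star (S k) * a * S l) (y (rho (star (S l)) v))).
    have -> : rho (star (S k)) (rho a v) =
        \sum_l rho (star (S k) * a * S l) (rho (star (S l)) v).
      rewrite -(repM rhoP) -{1}[star (S k) * a]mulr1 -(cuntz_sum A_cuntz) mulr_sumr.
      by rewrite (rep_sum rhoP); apply: eq_bigr => l _; rewrite mulrA (repM rhoP).
    rewrite (lin_sum ly) (lin_sum (lr _)); apply: eq_bigr => l _; congr (rho _ _).
    have /cy/funeqP/(_ (rho (star (S l)) v)) //= : (rho @` Fd S) (rho (star (S k) * a * S l)).
    by exists (star (S k) * a * S l) => //; apply: Fd_corner.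
  under eq_bigr => k _ do rewrite step.
  rewrite exchange_big (lin_sum (lr a)); apply: eq_bigr => l _ /=.
  under eq_bigr => k _ do rewrite -(repM rhoP) !mulrA.
  by rewrite -(rep_sum rhoP) -!mulr_suml (cuntz_sum A_cuntz) mul1r (repM rhoP).
have psi_gen k v : psi (rho (S k) v) = rho (S k) (y v).
  rewrite /psi (bigD1 k) //= -(repM rhoP) (cuntz_orth A_cuntz) eqxx (rep1 rhoP).
  rewrite big1 ?addr0 // => l /negPf lk.
  by rewrite -(repM rhoP) (cuntz_orth A_cuntz) lk (rep0 rhoP) (lin_0 ly) (lin_0 (lr _)).
have gen_psi k v : rho (star (S k)) (psi v) = y (rho (star (S k)) v).
  rewrite /psi (lin_sum (lr _)) (bigD1 k) //= -(repM rhoP) (cuntz_orth A_cuntz).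
  rewrite eqxx (rep1 rhoP) big1 ?addr0 // => l /negPf lk.
  by rewrite -(repM rhoP) (cuntz_orth A_cuntz) eq_sym lk (rep0 rhoP).
apply/funext => v /=; rewrite -psi_gen.
by have /funeqP/(_ (rho (S j) v)) /= -> := cm _ cpsi; rewrite gen_psi.
Qed.

Variable r : 'M[R[i]]_(d * d).
Hypothesis rP : is_rmatrix r.
Variable lambda : A -> A -> A.
Hypothesis lambdaP : is_lambda S lambda.
Local Notation phi := (canonical_endo S).
Local Notation Ru := (mx2_embed S r).
Local Notation g := (lambda Ru).
Variable f : (H -> H) -> (H -> H).
Hypothesis fP : is_extension dot rho Omega M N g f.

Local Notation X := (range (fun k => rho (iter k phi Ru))).

Let f_stable m : M m -> M (f m).
Proof. exact: (nendo_stable (ext_endo fP)). Qed.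

Lemma iter_stable n m : M m -> M (iter n f m).
Proof. by move=> Mm; elim: n => //= n; apply: f_stable. Qed.

Lemma f_sub m m' : M m -> M m' ->
  f (fun v => m v - m' v) = fun v => f m v - f m' v.
Proof.
move=> Mm Mm'; have := nendo_linear (ext_endo fP) (-1) Mm' Mm.
have -> : (fun v => -1 *: m' v + m v) = (fun v => m v - m' v).
  by apply/funext => v; rewrite scaleN1r addrC.
by move=> ->; apply/funext => v; rewrite scaleN1r addrC.
Qed.

(** Invariance of the state, applied to [m^* m]. This isometry is a substitute
    for the weak continuity of the extended endomorphism. *)
Lemma f_isometric m : M m -> hn (f m Omega) = hn (m Omega).
Proof.
move=> Mm; have [m' Mm' mm'] := M_adjoint Mm.
have m'm := adjoint_sym mm'.
have sqE n n' : adjoint_ops dot n' n ->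
    hn (n Omega) ^+ 2 = complex.Re (dot (n' (n Omega)) Omega).
  by move=> h; rewrite h -(rdot_hn dotP).
apply/eqP; rewrite -(@eqrXn2 _ 2) ?hn_ge0 //; apply/eqP.
rewrite (sqE _ _ m'm) (sqE _ _ (nendo_star (ext_endo fP) Mm' Mm m'm)).
have := ext_state fP (M_comp Mm' Mm).
by rewrite (nendo_mul (ext_endo fP) Mm' Mm) /= => ->.
Qed.

Lemma f_dist m m' : M m -> M m' ->
  hn (f m Omega - f m' Omega) = hn (m Omega - m' Omega).
Proof.
move=> Mm Mm'; have := f_isometric (M_sub Mm Mm').
by rewrite f_sub.
Qed.

Lemma M_eq m m' : M m -> M m' -> m Omega = m' Omega -> m = m'.
Proof.
move=> Mm Mm' e; have := separating A_cuntz d_gt0 dotP rhoP cyclic state_monomial (M_sub Mm Mm').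
rewrite e subrr => /(_ erefl)/funeqP h; apply/funext => v.
by apply/eqP; rewrite -subr_eq0; apply/eqP/h.
Qed.

(** On words this is the braid relation. It passes to [M] because both sides,
    applied to [Omega], depend continuously on [m Omega]: right multiplication
    by [R] is a bounded operator in the commutant. *)
Lemma f2_comm m : M m -> rho Ru \o f (f m) = f (f m) \o rho Ru.
Proof.
move=> Mm; have Mff : M (f (f m)) by do 2 apply: f_stable.
apply: M_eq; [exact: M_comp (M_rep _) _|exact: M_comp _ (M_rep _)|] => /=.
have sR : span (monomials S) Ru := span_core_monomials (mx2_embed_core S r).
have [c c0 bc] := right_bounded_words A_cuntz d_gt0 dotP rhoP state_monomial sR.
have [T [cT TE _]] := right_multiplication rhoP cyclic c0 bc.
have TO : T Omega = rho Ru Omega by have := TE 1; rewrite mul1r (rep1 rhoP).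
have Tcomm n : M n -> n (rho Ru Omega) = T (n Omega).
  by move=> [_ /(_ _ cT)/funeqP/(_ Omega)]; rewrite /= TO.
rewrite Tcomm //; apply/eqP; rewrite -subr_eq0; apply/eqP.
pose E := [set f (f (rho a)) Omega | a in span (monomials S)].
apply: (@bounded_eq0_closure _ _ (fun v => rho Ru v - T v) E).
- by apply: bounded_sub; [apply: (rep_bounded rhoP)|case: cT].
- move=> _ [a sa <-]; apply/eqP; rewrite subr_eq0 -Tcomm; last first.
    by do 2 apply: f_stable; apply: M_rep.
  rewrite !(ext_extends fP) -!(repM rhoP).
  by rewrite (endo2_comm A_cuntz rP lambdaP sa).
move=> e e0.
have [_ [a sa <-] ma] := cyclic_words A_cuntz dotP rhoP cyclic (m Omega) e0.
exists (f (f (rho a)) Omega); first by exists a.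
by rewrite !f_dist //; [exact: M_rep|exact: f_stable|apply: f_stable; exact: M_rep].
Qed.

(** Apply [f] repeatedly to the previous commutation: it maps [phi^k R] to
    [phi^(k+1) R]. *)
Lemma iter_comm k m : M m ->
  rho (iter k phi Ru) \o iter k.+2 f m = iter k.+2 f m \o rho (iter k phi Ru).
Proof.
move=> Mm; elim: k => [|k IH]; first exact: f2_comm.
have Mi := iter_stable k.+2 Mm.
rewrite -(endo_phi_iter A_cuntz rP lambdaP) -(ext_extends fP).
rewrite [iter k.+3 f m]iterS -!(nendo_mul (ext_endo fP)) //; try exact: M_rep.
by rewrite IH.
Qed.

Lemma phi_iter_unitary k : unitary (iter k phi Ru).
Proof.
elim: k => [|k [h1 h2]]; first exact: (rmatrix_unitary A_cuntz rP).
by rewrite /unitary iterS -phi_star -!(phiM A_cuntz) h1 h2 (phi1 A_cuntz).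
Qed.

(** Multiply [T u = u T] on both sides by the adjoint of the unitary [u]. *)
Lemma commutant_X_star T k : commutant X T ->
  T \o rho (star (iter k phi Ru)) = rho (star (iter k phi Ru)) \o T.
Proof.
move=> [_ cT]; have [h1 h2] := phi_iter_unitary k.
move: (cT _ (ex_intro2 _ _ k I erefl)) h1 h2.
move: (iter k phi Ru) => u cu h1 h2; apply/funext => v /=.
rewrite -[T _](rep1 rhoP) -h1 (repM rhoP); congr (rho _ _).
have /funeqP/(_ (rho (star u) v)) /= <- := cu.
by rewrite -(repM rhoP) h2 (rep1 rhoP).
Qed.

Lemma commutant_X_adjoint T : commutant X T ->
  exists2 T', commutant X T' & adjoint_ops dot T T'.
Proof.
move=> cT; pose Y := X `|` range (fun k => rho (star (iter k phi Ru))).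
have cY : commutant Y T.
  split; first by case: cT.
  by move=> _ [[k _ <-]|[k _ <-]]; [apply: (proj2 cT); exists k|exact: commutant_X_star].
have starY T1 : Y T1 -> exists2 T2, Y T2 & adjoint_ops dot T1 T2.
  case=> -[k _ <-].
    by exists (rho (star (iter k phi Ru))); [right; exists k|apply: (rep_star rhoP)].
  exists (rho (iter k phi Ru)); first by left; exists k.
  exact/adjoint_sym/(rep_star rhoP).
have [T' cT' TT'] := commutant_has_adjoints dotP starY cY.
by exists T' => //; apply: commutantS cT' => T1; left.
Qed.

Lemma commutant_L : commutant (vn_generated dot X) = commutant X.
Proof.
apply: commutant_vn_generated; last exact: commutant_X_adjoint.
by move=> _ [k _ <-]; apply: (rep_bounded rhoP).
Qed.

Lemma commutant_X_cocycle m n k : commutant X m ->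
  m \o rho (iter k phi (cocycle S r n)) = rho (iter k phi (cocycle S r n)) \o m.
Proof.
move=> [_ cm]; elim: n k => [|n IH] k /=.
  have -> : iter k phi 1 = 1 by elim: k => //= k ->; apply: phi1.
  by rewrite (rep_unit rhoP).
have -> : iter k phi (Ru * phi (cocycle S r n)) =
    iter k phi Ru * iter k.+1 phi (cocycle S r n).
  by rewrite iterSr; elim: k => //= k ->; rewrite (phiM A_cuntz).
rewrite (rep_mul rhoP) compA; have -> : m \o rho (iter k phi Ru) = rho (iter k phi Ru) \o m.
  by rewrite cm //; exists k.
by rewrite -compA IH compA.
Qed.

(** On the [n]-th matrix algebra of the core the endomorphism is conjugation by a
    unitary of [L], which has no effect on [m]. If [a] is a core element with
    [a Omega] close to [m Omega], then [f a Omega] is as close to [m Omega], since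
    right multiplication by a unitary of the core is isometric. *)
Lemma core_fixed m : N m -> commutant X m -> f m = m.
Proof.
move=> Nm cm; have Mm := N_sub_M Nm.
apply: M_eq => //; first exact: f_stable.
apply/eqP; rewrite -subr_eq0; apply/eqP/hn_small_eq0 => e e0.
have [|_ [n [a [sa ->]]] ma] := N_approx Nm (e := e / 2); first by rewrite divr_gt0.
set c := cocycle S r n.
have [c1 c2] := cocycle_unitary A_cuntz rP n.
have cs : span (core_monomials S n.+1) (star c).
  exact/span_core_star/(cocycle_core A_cuntz).
have bc : right_bounded rho Omega (star c) 1.
  by apply: (right_bounded_unitary A_cuntz d_gt0 dotP rhoP state_monomial cs); rewrite starK.
have [T [cT TE Tle]] := right_multiplication rhoP cyclic ler01 bc.
have TO : T Omega = rho (star c) Omega by have := TE 1; rewrite mul1r (rep1 rhoP).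
have Mma := M_sub (M_rep a) Mm.
have fa : hn (f m Omega - f (rho a) Omega) < e / 2.
  by rewrite f_dist //; apply: M_rep.
have fam : hn (f (rho a) Omega - m Omega) <= e / 2.
  have mE : m Omega = rho c (m (rho (star c) Omega)).
    have /funeqP/(_ (rho (star c) Omega)) /= := commutant_X_cocycle n 0 cm.
    by rewrite -/c => <-; rewrite -(repM rhoP) c2 (rep1 rhoP).
  rewrite mE (ext_extends fP) (endo_core A_cuntz rP lambdaP sa) -/c -mulrA.
  rewrite !(repM rhoP) -(lin_sub (rep_lin rhoP c)).
  have cle v : hn (rho c v) = hn v.
    apply/eqP; rewrite -(@eqrXn2 _ 2) ?hn_ge0 // -!(rdot_hn dotP); apply/eqP.
    by rewrite (rep_rdot rhoP) -(repM rhoP) c1 (rep1 rhoP).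
  rewrite cle.
  have -> : rho a (rho (star c) Omega) - m (rho (star c) Omega) =
      T (rho a Omega - m Omega).
    by rewrite -TO; case: Mma => _ /(_ _ cT)/funeqP/(_ Omega).
  by apply: le_trans (Tle _) _; rewrite mul1r hn_distC ltW.
apply: le_trans (hn_triangle (f (rho a) Omega) _ _) _.
by rewrite (splitr e) lerD // ltW.
Qed.

Lemma iterated_ranges_commute m : iterated_ranges M f m -> commutant X m.
Proof.
move=> im; have [m1 Mm1 m1E] := im 1%N isT.
split; first by rewrite -m1E; case: (f_stable Mm1).
by move=> _ [k _ <-]; have [m2 Mm2 <-] := im k.+2 isT; rewrite iter_comm.
Qed.

Lemma fixed_iterated (P : set (H -> H)) m : P m -> f m = m -> iterated_ranges P f m.
Proof.
by move=> Pm fm n _; exists m => //; elim: n => //= n ->.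
Qed.

(** The image of [S_i^* m S_j] is [S_i^* R^* m R S_j], and a fixed point [m]
    commutes with [R]. *)
Lemma fixed_corner i j m : fixed_points M f m ->
  fixed_points M f (rho (star (S i)) \o m \o rho (S j)).
Proof.
move=> [Mm fm]; have [_ g_gen] := lambdaP (rmatrix_unitary A_cuntz rP).
have [[_ _ _ g_star] _] := lambdaP (rmatrix_unitary A_cuntz rP).
have Mim : M (rho (star (S i)) \o m) by apply: M_comp => //; apply: M_rep.
split; first by apply: M_comp => //; apply: M_rep.
rewrite (nendo_mul (ext_endo fP) Mim (M_rep _)).
rewrite (nendo_mul (ext_endo fP) (M_rep _) Mm).
rewrite !(ext_extends fP) fm g_star g_gen g_gen starM; apply/funext => v /=.
rewrite !(repM rhoP).
have := iterated_ranges_commute (fixed_iterated Mm fm).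
case=> _ /(_ (rho Ru)) /(_ (ex_intro2 _ _ 0%N I erefl))/funeqP/(_ (rho (S j) v)) /= ->.
have [u1 _] := rmatrix_unitary A_cuntz rP.
by rewrite -(repM rhoP (star Ru)) u1 (rep1 rhoP).
Qed.

Lemma fixed_points_endo :
  let L := vn_generated dot X in
  let Mfix := fixed_points M f in
  let Nfix := Mfix `&` N in
  [/\ Mfix `<=` iterated_ranges M f
      /\ iterated_ranges M f `<=` commutant L `&` M,
      Nfix = iterated_ranges N f
      /\ iterated_ranges N f = commutant L `&` N &
      forall i j : 'I_d,
        (forall m, Mfix m -> Mfix (rho (star (S i)) \o m \o rho (S j))) /\
        (forall m, Nfix m -> Nfix (rho (star (S i)) \o m \o rho (S j)))].
Proof.
move=> L Mfix Nfix; rewrite /L commutant_L.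
have NiN m : iterated_ranges N f m -> N m.
  by move=> /(_ 1%N isT)[m1 Nm1 <-]; apply: (ext_stable fP); exists m1.
have NiM m : iterated_ranges N f m -> iterated_ranges M f m.
  by move=> im n n1; have [m1 Nm1 <-] := im n n1; exists m1 => //; apply: N_sub_M.
have s1 : Nfix `<=` iterated_ranges N f.
  by move=> m [[_ fm] Nm]; apply: fixed_iterated.
have s2 : iterated_ranges N f `<=` commutant X `&` N.
  by move=> m im; split; [apply/iterated_ranges_commute/NiM|apply: NiN].
have s3 : commutant X `&` N `<=` Nfix.
  by move=> m [cm Nm]; split=> //; split; [apply: N_sub_M|apply: core_fixed].
split.
- split=> m; first by case; apply: fixed_iterated.
  move=> im; split; first exact: iterated_ranges_commute.
  by have [m1 Mm1 <-] := im 1%N isT; apply: f_stable.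
- split; apply/seteqP; split=> //.
    by move=> m /s2/s3.
  by move=> m /s3/s1.
move=> i j; split=> m; first exact: fixed_corner.
by move=> [Mm Nm]; split; [apply: fixed_corner|apply: N_corner].
Qed.

End Core.

(** * The theorem *)

Theorem proposition7p1 (R : realType) (d : nat) (d_ge2 : (2 <= d)%N)
  (A : cstarAlgType R) (S : 'I_d -> A) (A_cuntz : is_cuntz_algebra S)
  (lambda : A -> A -> A) (lambdaP : is_lambda S lambda)
  (tau : A -> R[i]) (tauP : is_normalized_trace S tau)
  (E0 : A -> A) (E0P : is_gauge_expectation lambda E0)
  (H : completeNormedModType R[i]) (dot : {dot H for Num.conj})
  (dotP : is_hilbert_dot dot)
  (rho : A -> H -> H) (Omega : H)
  (gnsP : is_gns dot (fun x => tau (E0 x)) rho Omega)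
  (r : 'M[R[i]]_(d * d)) (rP : is_rmatrix r)
  (lambdaR : (H -> H) -> (H -> H))
  (lambdaRP : is_extension dot rho Omega
     (bicommutant (range rho)) (bicommutant (rho @` Fd S))
     (lambda (mx2_embed S r)) lambdaR) :
  let M := bicommutant (range rho) in
  let N := bicommutant (rho @` Fd S) in
  let L := vn_generated dot
    (range (fun k => rho (iter k (canonical_endo S) (mx2_embed S r)))) in
  let Mfix := fixed_points M lambdaR in
  let Nfix := Mfix `&` N in
  [/\ Mfix `<=` iterated_ranges M lambdaR
      /\ iterated_ranges M lambdaR `<=` commutant L `&` M,
      Nfix = iterated_ranges N lambdaR
      /\ iterated_ranges N lambdaR = commutant L `&` N &
      forall i j : 'I_d,
        (forall x, Mfix x -> Mfix (rho (star (S i)) \o x \o rho (S j))) /\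
        (forall x, Nfix x -> Nfix (rho (star (S i)) \o x \o rho (S j)))].

Proof.
have d_gt0 : (0 < d)%N by apply: ltn_trans d_ge2.
have [rhoP cyclic state] := gnsP.
apply: (fixed_points_endo A_cuntz d_gt0 dotP rhoP cyclic _ rP lambdaP lambdaRP).
by move=> mu nu; rewrite state (omega_monomial A_cuntz d_gt0 lambdaP E0P tauP).
Qed.
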